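(* Let $P:\mathcal{M}(\mathbb{C})^N\to\mathcal{M}(\mathbb{C})^N$ be a free polynomial map. If $P$ is injective, then $P$ is surjective, and for every $n\ge 1$ the restriction $P^{-1}|_{\mathcal{M}_n(\mathbb{C})^N}$ agrees with (the evaluation on $\mathcal{M}_n(\mathbb{C})^N$ of) some free polynomial map (which may depend on $n$).
   Context: $\mathcal{M}_n(\mathbb{C})$ denotes the $n\times n$ complex matrices and $\mathcal{M}(\mathbb{C})^N=\bigcup_{n\ge1}\mathcal{M}_n(\mathbb{C})^N$. A free polynomial map $P=(p_1,\dots,p_N)$ is an $N$-tuple of noncommutative polynomials in $N$ variables with complex coefficients, evaluated on $X=(X_1,\dots,X_N)\in\mathcal{M}_n(\mathbb{C})^N$ by substituting $X_i$ for the $i$-th variable (constants $c$ becoming $cI_n$); it maps $\mathcal{M}_n(\mathbb{C})^N$ to itself. *)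

(* Defs.v *)
From HB Require Import structures.
From mathcomp Require Import all_boot all_order all_algebra.
Set Implicit Arguments. Unset Strict Implicit. Unset Printing Implicit Defensive.
Import Order.TTheory GRing.Theory Num.Theory.
Local Open Scope ring_scope.

(* Noncommutative polynomials in N variables with coefficients in R,
   represented syntactically (as elements of the free algebra R<x_0..x_{N-1}>).
   Every noncommutative polynomial is (the value of) such an expression. *)
Inductive ncpoly (N : nat) (R : Type) : Type :=
| NCVar of 'I_N
| NCConst of R
| NCAdd of ncpoly N R & ncpoly N R
| NCMul of ncpoly N R & ncpoly N R.

Arguments NCVar {N R} _.
Arguments NCConst {N R} _.

Fixpoint nceval (R : pzRingType) (N n : nat) (p : ncpoly N R)
    (X : {ffun 'I_N -> 'M[R]_n}) : 'M[R]_n :=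
  match p with
  | NCVar i => X i
  | NCConst c => c%:M
  | NCAdd p q => nceval p X + nceval q X
  | NCMul p q => nceval p X *m nceval q X
  end.

Definition free_poly_map (N : nat) (R : Type) := 'I_N -> ncpoly N R.

Definition fpm_eval (R : pzRingType) (N n : nat) (P : free_poly_map N R)
    (X : {ffun 'I_N -> 'M[R]_n}) : {ffun 'I_N -> 'M[R]_n} :=
  [ffun i => nceval (P i) X].

(* Main.v *)
Require Import Defs.
From HB Require Import structures.
From mathcomp Require Import all_boot all_order all_algebra all_field.
From mathcomp Require boolp classical_sets.
From mathcomp Require Import ssrcomplements mpoly ring.
Set Implicit Arguments. Unset Strict Implicit. Unset Printing Implicit Defensive.
Import GRing.Theory Num.Theory.
Local Open Scope ring_scope.

(* Fix n and let p be the polynomial map given by P on the entries of M_n(C)^N.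
   Injectivity at level 2n, applied to block upper triangular matrices, makes the
   Jacobian of p between any two points invertible; its determinant is then a nonzero
   constant, so x - x' = Q(x,x') (p(x) - p(x')) for a polynomial matrix Q.  This
   identity ("p is certified") survives base change, and gives three things.
   Over finite fields it makes p injective, hence onto; by specialization to finite
   fields, b(p) x_i = a(p) and b(y) = 0 force a(y) = 0 over C.  It makes
   C(p) -> C(x) an epimorphism of fields, so each x_i is a rational function of p.
   Restricted to a generic line these rational functions have no pole, by the first
   point, so p has a polynomial inverse F.  Finally P has a formal free inverse
   at 0; along Y = P(0) + s Z it agrees with F modulo any power of s, and F has
   bounded degree in s, so a truncation of the formal inverse is the required
   free polynomial. *)

(** * Specialization to finite fields *)

Lemma finField_root (k : finFieldType) (p : {poly k}) : (1 < size p)%N ->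
  exists (k' : finFieldType) (f : {rmorphism k -> k'}) (x : k'),
    (map_poly f p).[x] = 0.
Proof.
move=> p_gt1; have p0: p != 0 by rewrite -size_poly_gt0 (ltn_trans _ p_gt1).
have [L [rs def_p _]] := FinSplittingFieldFor p0.
pose f : {rmorphism k -> FinFieldExtType L} := in_alg L.
have szp : size (map_poly (in_alg L) p) = (size rs).+1.
  by rewrite (eqp_size def_p) size_prod_XsubC.
case: rs def_p szp => [|z rs] def_p szp.
  by move: p_gt1; rewrite size_map_poly in szp; rewrite szp.
exists (FinFieldExtType L), f, z; apply/eqP.
have : root (map_poly (in_alg L) p) z.
  by rewrite (eqp_root def_p) root_prod_XsubC mem_head.
by [].
Qed.

Section HornerMorph.
Variables (T : comNzRingType) (K : comNzRingType) (f : {rmorphism T -> K}) (z : K).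

Definition hmorph (p : {poly T}) : K := (map_poly f p).[z].

HB.instance Definition _ :=
  GRing.RMorphism.copy hmorph (horner_eval z \o map_poly f).

Lemma hmorphE p : hmorph p = (map_poly f p).[z]. Proof. by []. Qed.
Lemma hmorphC c : hmorph c%:P = f c.
Proof. by rewrite hmorphE map_polyC hornerC. Qed.
Lemma hmorphX : hmorph 'X = z.
Proof. by rewrite hmorphE map_polyX hornerX. Qed.
Lemma hmorphZ c p : hmorph (c *: p) = f c * hmorph p.
Proof. by rewrite -mul_polyC rmorphM /= hmorphC. Qed.
Lemma hmorphD p q : hmorph (p + q) = hmorph p + hmorph q.
Proof. exact: rmorphD. Qed.
Lemma hmorphB p q : hmorph (p - q) = hmorph p - hmorph q.
Proof. exact: rmorphB. Qed.
Lemma hmorphM p q : hmorph (p * q) = hmorph p * hmorph q.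
Proof. exact: rmorphM. Qed.
Lemma hmorph_map0 p : map_poly f p = 0 -> hmorph p = 0.
Proof. by rewrite hmorphE => ->; rewrite horner0. Qed.
End HornerMorph.
Arguments hmorph : simpl never.

(* The pairs (T, zeta) model the finitely generated subrings of K. *)
Definition specializable (K : fieldType) (T : comNzRingType) (zeta : {rmorphism T -> K}) :=
  forall c, zeta c != 0 -> exists (k : finFieldType) (om : {rmorphism T -> k}),
    (forall f, zeta f = 0 -> om f = 0) /\ om c != 0.

Section Adjoin.
Variables (K : fieldType) (T : comNzRingType) (zeta : {rmorphism T -> K}).
Variable z : K.
Local Notation ev := (hmorph zeta z).

(** As [zeta] need not be injective, top coefficients of [g] may die in [K]. Dropping them makes
    sizes over [T] and [K] agree, as the pseudo-divisions below require. *)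
Lemma truncated (g : {poly T}) : map_poly zeta g != 0 ->
  exists g', [/\ map_poly zeta g' = map_poly zeta g, size g' = size (map_poly zeta g)
    & zeta (lead_coef g') != 0].
Proof.
set s := size _; move=> g0; have s0 : (0 < s)%N by rewrite size_poly_gt0.
pose g' := \poly_(i < s) g`_i.
have lg : zeta g`_s.-1 != 0.
  by rewrite -coef_map -lead_coefE lead_coef_eq0.
have sg : size g' = s.
  rewrite size_poly_eq //; by apply: contraNneq lg => ->; rewrite rmorph0.
exists g'; split=> //.
  apply/polyP=> i; rewrite !coef_map [g'`_i]coef_poly; case: ltnP => // le_si.
  by rewrite raddf0 -coef_map nth_default.
by rewrite lead_coefE sg coef_poly prednK // leqnn.
Qed.

Hypothesis sp : specializable zeta.

Lemma ex_minsize (Q : {poly T} -> Prop) : (exists g, Q g) ->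
  exists g, Q g /\ forall g', Q g' -> (size g <= size g')%N.
Proof.
case=> g; have [n le_n] := ubnP (size g).
elim: n g le_n => // n IH g le_n Qg.
have [[g' [Qg' lt_g']]|H] := boolp.pselect (exists g', Q g' /\ (size g' < size g)%N).
  by apply: IH Qg'; apply: leq_trans lt_g' _.
exists g; split=> // g' Qg'; rewrite leqNgt; apply/negP=> lt_g'; apply: H; by exists g'.
Qed.

(** If [z] is transcendental over the image of [zeta], a polynomial killing [z] has all its
    coefficients in the kernel of [zeta], so ['X] may be sent anywhere. Otherwise ['X] is sent to a
    root of the reduction of a smallest annihilator [mu] of [z], and pseudo-division by [mu] shows
    that the kernel of [ev] is respected. *)
Lemma specializable_adjoin : specializable ev.
Proof.
move=> c /= c0.
have [[g [g0 evg]]|trans] := boolp.pselect (exists g, map_poly zeta g != 0 /\ ev g = 0); last first.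
  have {}trans g : ev g = 0 -> map_poly zeta g = 0.
    by move=> evg; apply: boolp.contrapT => /eqP g0; apply: trans; exists g.
  have [i ci] : exists i, zeta c`_i != 0.
    exists (size (map_poly zeta c)).-1.
    rewrite -coef_map -lead_coefE lead_coef_eq0.
    by apply: contraNneq c0 => /hmorph_map0 ->.
  have [k [om [kerom omc]]] := sp ci.
  have cz : map_poly om c != 0.
    by apply: contraNneq omc => e; rewrite -coef_map e coef0.
  (* A root x of X c(X) - 1 satisfies c(x) != 0. *)
  have [|k' [f [x fx]]] := @finField_root k ('X * map_poly om c - 1).
    rewrite size_polyDl; last rewrite size_polyN size_poly1.
      by rewrite mulrC size_mulX // ltnS size_poly_gt0.
    by rewrite mulrC size_mulX // ltnS size_poly_gt0.
  exists k', (hmorph (f \o om) x); split=> [g /trans g0|].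
    apply: hmorph_map0; apply/polyP=> j; rewrite coef_map coef0 /=.
    by rewrite kerom ?rmorph0 // -coef_map g0 coef0.
  apply/eqP=> c1; move: fx; rewrite rmorphB rmorphM rmorph1 /= map_polyX !hornerE.
  by rewrite -map_poly_comp -hmorphE c1 mulr0 sub0r => /eqP; rewrite oppr_eq0 oner_eq0.
pose lc (g : {poly T}) := zeta (lead_coef g) != 0.
have sz_lc h : lc h -> size (map_poly zeta h) = size h.
  by move=> lh; rewrite size_poly_eq.
have lc0 h : lc h -> h != 0.
  by rewrite /lc; apply: contraNneq => ->; rewrite lead_coef0 rmorph0.
have [mu [[lmu evmu] minmu]] : exists mu, (lc mu /\ ev mu = 0) /\
    forall g', lc g' /\ ev g' = 0 -> (size mu <= size g')%N.
  apply: ex_minsize; have [g' [e1 _ lg']] := truncated g0.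
  by exists g'; split; rewrite // hmorphE e1.
have minmu' rho : (size (map_poly zeta rho) < size mu)%N -> ev rho = 0 -> map_poly zeta rho = 0.
  move=> lt_rho ev_rho; apply: boolp.contrapT => /eqP rho0.
  have [g' [e1 sg' lg']] := truncated rho0.
  have := minmu g'; rewrite hmorphE e1 -hmorphE sg' leqNgt lt_rho.
  by move/(_ (conj lg' ev_rho)).
have szm (h : {poly T}) : (size (map_poly zeta h) <= size h)%N by apply: size_poly.
have division p q : lc q -> exists u r e,
    [/\ lead_coef q ^+ e *: p = u * q + r & (size r < size q)%N].
  move=> lq; exists (Pdiv.Ring.rdivp p q), (Pdiv.Ring.rmodp p q), (Pdiv.Ring.rscalp p q).
  split; first exact: Pdiv.ComRing.rdivp_eq.
  by rewrite Pdiv.Ring.ltn_rmodp lc0.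
have mu2 : (1 < size mu)%N.
  rewrite ltnNge; apply/negP=> /size1_polyC mu1.
  by move: evmu lmu; rewrite mu1 /lc lead_coefC hmorphC => ->; rewrite eqxx.
have evX g' e p : lc g' -> (ev (lead_coef g' ^+ e *: p) == 0) = (ev p == 0).
  by move=> lg'; rewrite hmorphZ mulf_eq0 rmorphXn expf_eq0 (negPf lg') andbF.
(* Some multiple of [c] is a nonzero constant at [z]. Take a nonvanishing multiple [g2] of least
   size. If it were not constant, dividing [mu] by it would leave either a smaller multiple or a
   factor of [mu] that kills [z], against the minimality of [mu]. *)
have [h [d [ech d0]]] : exists h d, ev (c * h) = zeta d /\ zeta d != 0.
  pose Q g := [/\ lc g, ev g != 0 & exists h, ev g = ev (c * h)].
  have trQ g' : ev g' != 0 -> (exists h, ev g' = ev (c * h)) ->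
      exists2 g2, Q g2 & (size g2 <= size g')%N.
    move=> e0 eh; have [|g2 [e1 sg2 lg2]] := @truncated g'.
      by apply: contraNneq e0 => /hmorph_map0 ->.
    by exists g2; rewrite ?sg2 //; split; rewrite // hmorphE e1.
  have [g1 Qg1 sg1] : exists2 g1, Q g1 & (size g1 < size mu)%N.
    have [u [r [e [def_r sr]]]] := division c mu lmu.
    have evr : ev r = ev (lead_coef mu ^+ e *: c) by rewrite def_r hmorphD hmorphM evmu mulr0 add0r.
    have [||g2 Qg2 sg2] := trQ r; first by rewrite evr evX.
      by exists (lead_coef mu ^+ e)%:P; rewrite evr -mul_polyC mulrC.
    by exists g2; rewrite // (leq_ltn_trans sg2).
  have [g2 [[lg2 eg2 [h eh]] ming2]] : exists g, Q g /\ forall g', Q g' -> (size g <= size g')%N.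
    by apply: ex_minsize; exists g1.
  have sg2 : (size g2 < size mu)%N by apply: leq_ltn_trans (ming2 _ Qg1) _.
  have [sg2_1|sg2_1] := leqP (size g2) 1.
    have g2E := size1_polyC sg2_1; exists h, g2`_0.
    have gd : ev g2 = zeta g2`_0 by rewrite {1}g2E hmorphC.
    by rewrite -eh -gd.
  have [u [r [e [def_r sr]]]] := division mu g2 lg2.
  have evur : ev u * ev g2 + ev r = 0.
    by rewrite -hmorphM -hmorphD -def_r hmorphZ evmu mulr0.
  have er : ev r = 0.
    apply/eqP; apply: contraT => er0; have [||g3 /ming2 le3 sg3] := trQ r; first by [].
      exists (- u * h); rewrite mulrCA hmorphM -eh -[- u]sub0r hmorphB rmorph0 sub0r mulNr.
      by apply/eqP; rewrite -addr_eq0 addrC evur.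
    by move: (leq_trans le3 sg3); rewrite leqNgt sr.
  have eu : ev u = 0.
    by move/eqP: evur; rewrite er addr0 mulf_eq0 (negPf eg2) orbF => /eqP.
  have mr : map_poly zeta r = 0.
    by apply: minmu' => //; apply: leq_ltn_trans (szm r) _; apply: ltn_trans sr _.
  have meq : map_poly zeta u * map_poly zeta g2 = zeta (lead_coef g2) ^+ e *: map_poly zeta mu.
    have := congr1 (map_poly zeta) def_r.
    by rewrite rmorphD rmorphM /= mr addr0 map_polyZ rmorphXn => ->.
  have mu0 : map_poly zeta mu != 0 by rewrite -size_poly_gt0 sz_lc // (ltn_trans _ mu2).
  have l0 : zeta (lead_coef g2) ^+ e != 0 by rewrite expf_neq0.
  have mu_u : map_poly zeta u != 0.
    apply: contraTneq l0 => u0; move/eqP: meq; rewrite u0 mul0r eq_sym scaler_eq0.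
    by rewrite (negPf mu0) orbF negbK.
  have := congr1 (fun p : {poly K} => size p) meq.
  have mg2 : map_poly zeta g2 != 0 by rewrite -size_poly_gt0 sz_lc // (ltn_trans _ sg2_1).
  rewrite size_scale // size_mul // (sz_lc _ lg2) (sz_lc _ lmu) => szu.
  case/eqP: mu_u; apply: minmu' => //; rewrite -szu.
  by case: (size g2) sg2_1 => [|[|n]] // _; rewrite !addnS /= ltnS leq_addr.
(* The leading coefficient must survive so that [mu] keeps its size, hence a root, and so that its
   powers can be cancelled after pseudo-division. As [c * h] becomes [d], keeping [d] nonzero keeps
   [c] nonzero. *)
have [|k [om [kerom omc]]] := sp (c := lead_coef mu * d).
  by rewrite rmorphM mulf_neq0.
have [oml omd] : om (lead_coef mu) != 0 /\ om d != 0.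
  by apply/andP; rewrite -negb_or -mulf_eq0 -rmorphM.
have [|k' [f [x fx]]] := @finField_root k (map_poly om mu).
  by rewrite size_poly_eq.
pose om' := hmorph (f \o om) x.
have kerom' g' : ev g' = 0 -> om' g' = 0.
  move=> evg'; have [u [r [e [def_r sr]]]] := division g' mu lmu.
  have evr : ev r = 0.
    have := congr1 ev def_r; rewrite hmorphD hmorphM evmu mulr0 add0r hmorphZ evg' mulr0.
    by move=> ->.
  have mr := minmu' r (leq_ltn_trans (szm r) sr) evr.
  have omr : om' r = 0.
    apply: hmorph_map0; apply/polyP=> j; rewrite coef_map coef0 /=.
    by rewrite kerom ?rmorph0 // -coef_map mr coef0.
  have ommu : om' mu = 0 by rewrite /om' hmorphE map_poly_comp.
  have := congr1 om' def_r; rewrite /om' hmorphD hmorphM hmorphZ -/(om' r) -/(om' mu).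
  rewrite ommu omr mulr0 addr0 /=.
  move/eqP; rewrite mulf_eq0 rmorphXn fmorph_eq0 expf_eq0 (negPf oml) andbF /=.
  by move/eqP.
exists k', om'; split=> //; apply: contraNneq omd => omc0.
have : om' (c * h - d%:P) = 0.
  by apply: kerom'; rewrite hmorphB ech hmorphC subrr.
rewrite /om' hmorphB hmorphM -/(om' c) [om' c]omc0 mul0r sub0r hmorphC /= => /eqP.
by rewrite oppr_eq0 fmorph_eq0.
Qed.
End Adjoin.

Lemma specializable_int (K : fieldType) : [pchar K] =i pred0 ->
  specializable (intr : {rmorphism int -> K}).
Proof.
move=> K0 c c0; have c1 : c != 0 by apply: contraNneq c0 => ->.
have [p lt_p pr_p] := prime_above `|c|.
have nat0 n : (n%:R == 0 :> K) = (n == 0)%N by have /pcharf0P -> := K0.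
exists 'F_p, intr; split=> [f f0|].
  suff -> : f = 0 by rewrite rmorph0.
  case: f f0 => n /eqP; first by rewrite -[X in X == 0]/(n%:R : K) nat0 => /eqP ->.
  by rewrite NegzE rmorphN oppr_eq0 -[X in X == 0]/(n.+1%:R : K) nat0.
have : ~~ (p %| `|c|)%N.
  by rewrite gtnNdvd // lt0n absz_eq0.
have ncp n : ~~ (p %| n)%N -> n%:R != 0 :> 'F_p.
  by rewrite (dvdn_pcharf (pchar_Fp pr_p)).
case: c {c0 c1 lt_p} => n /= /ncp //.
by rewrite NegzE rmorphN oppr_eq0.
Qed.

Lemma ex_specializable (K : fieldType) (s : seq K) : [pchar K] =i pred0 ->
  exists (T : comNzRingType) (zeta : {rmorphism T -> K}),
    specializable zeta /\ forall x, x \in s -> exists t, zeta t = x.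
Proof.
move=> K0; elim: s => [|x s [T [zeta [sp im]]]].
  by exists int, intr; split=> //; apply: specializable_int.
exists {poly T}, (hmorph zeta x); split; first exact: specializable_adjoin.
move=> y; rewrite inE => /predU1P[->|/im[t <-]].
  by exists 'X; rewrite /= hmorphX.
by exists t%:P; rewrite /= hmorphC.
Qed.

(** * Certified polynomial maps *)

Section MMap.
Lemma mmap_morph n (R : nzRingType) (S S' : comNzRingType) (g : {rmorphism S -> S'})
    (f : {rmorphism R -> S}) (h : 'I_n -> S) p :
  g (mmap f h p) = mmap (g \o f) (g \o h) p.
Proof.
rewrite /mmap rmorph_sum; apply: eq_bigr => a _ /=; rewrite rmorphM; congr (_ * _).
by rewrite /mmap1 rmorph_prod; apply: eq_bigr => i _; rewrite rmorphXn.
Qed.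

Lemma eq_mmap n (R S : nzRingType) (f f' : R -> S) (h h' : 'I_n -> S) :
  f =1 f' -> h =1 h' -> mmap f h =1 mmap f' h'.
Proof.
move=> ef eh p; rewrite /mmap; apply: eq_bigr => a _.
by rewrite ef (mmap1_eq _ eh).
Qed.

Lemma mmapU n (R S : nzRingType) (f : {rmorphism R -> S}) (h : 'I_n -> S) i :
  mmap f h 'X_i = h i.
Proof. by rewrite mmapX mmap1U. Qed.

Lemma mmap_map n (R S : nzRingType) (S' : comNzRingType) (f : {rmorphism S -> S'})
    (g : {rmorphism R -> S}) (h : 'I_n -> S') p :
  mmap f h (map_mpoly g p) = mmap (f \o g) h p.
Proof.
rewrite /map_mpoly {2}/mmap raddf_sum /=; apply: eq_bigr => a _.
by rewrite mul_mpolyC mmapZ mmap1_id mmapX.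
Qed.

Lemma mmap_id n (R : comNzRingType) (p : {mpoly R[n]}) :
  mmap (@mpolyC n R) (fun i => 'X_i) p = p.
Proof.
rewrite /mmap [RHS]mpolyE; apply: eq_bigr => a _.
by rewrite mmap1_id mul_mpolyC.
Qed.
End MMap.

Definition catf m (B : Type) (X X' : 'I_m -> B) (k : 'I_(m + m)) :=
  match split k with inl i => X i | inr i => X' i end.

Lemma catf_l m (B : Type) (X X' : 'I_m -> B) i : catf X X' (lshift m i) = X i.
Proof. by rewrite /catf -[lshift m i]/(unsplit (inl i)) unsplitK. Qed.
Lemma catf_r m (B : Type) (X X' : 'I_m -> B) i : catf X X' (rshift m i) = X' i.
Proof. by rewrite /catf -[rshift m i]/(unsplit (inr i)) unsplitK. Qed.

Section Cert.
Variables (m : nat).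
Definition lvars (R : comNzRingType) : {mpoly R[m]} -> {mpoly R[m + m]} :=
  mmap (@mpolyC (m + m) R) (fun i => 'X_(lshift m i)).
Definition rvars (R : comNzRingType) : {mpoly R[m]} -> {mpoly R[m + m]} :=
  mmap (@mpolyC (m + m) R) (fun i => 'X_(rshift m i)).
Definition cert_defect (R : comNzRingType) (p : 'I_m -> {mpoly R[m]})
    (Q : 'I_m -> 'I_m -> {mpoly R[m + m]}) i : {mpoly R[m + m]} :=
  'X_(lshift m i) - 'X_(rshift m i) - \sum_j Q i j * (lvars (p j) - rvars (p j)).

(* An algebraic witness that p is injective and etale over every commutative R-algebra. *)
Definition certified (R : comNzRingType) (p : 'I_m -> {mpoly R[m]}) Q :=
  forall i, cert_defect p Q i = 0.

Lemma certified_eval (R B : comNzRingType) (f : {rmorphism R -> B}) p Q (X X' : 'I_m -> B) i :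
  certified p Q ->
  X i - X' i = \sum_j mmap f (catf X X') (Q i j) * (mmap f X (p j) - mmap f X' (p j)).
Proof.
move=> /(_ i)/(congr1 (mmap f (catf X X'))).
rewrite raddf0 !raddfB /= !mmapU catf_l catf_r => /eqP; rewrite subr_eq0 => /eqP ->.
rewrite rmorph_sum; apply: eq_bigr => j _; rewrite rmorphM rmorphB /=; congr (_ * (_ - _)).
  rewrite /lvars mmap_morph; apply: eq_mmap => [c|k] /=; first by rewrite mmapC.
  by rewrite mmapU catf_l.
rewrite /rvars mmap_morph; apply: eq_mmap => [c|k] /=; first by rewrite mmapC.
by rewrite mmapU catf_r.
Qed.

Lemma cert_defect_map (R S : comNzRingType) (f : {rmorphism R -> S}) p Q i :
  map_mpoly f (cert_defect p Q i) =
  cert_defect (fun j => map_mpoly f (p j)) (fun i j => map_mpoly f (Q i j)) i.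
Proof.
rewrite !raddfB /= !map_mpolyX rmorph_sum; congr (_ - _); apply: eq_bigr => j _.
rewrite rmorphM rmorphB /= /lvars /rvars; congr (_ * (_ - _)).
  rewrite mmap_morph mmap_map; apply: eq_mmap => [c|k] /=; first by rewrite map_mpolyC.
  by rewrite map_mpolyX.
rewrite mmap_morph mmap_map; apply: eq_mmap => [c|k] /=; first by rewrite map_mpolyC.
by rewrite map_mpolyX.
Qed.
End Cert.

(** * Surjectivity by reduction to finite fields *)

Definition coefs n (R : nzRingType) (p : {mpoly R[n]}) := [seq p@_a | a <- msupp p].

Lemma coefs_lift n (R S : nzRingType) (f : {rmorphism S -> R}) (g : R -> S) (p : {mpoly R[n]}) :
  {in coefs p, cancel g f} ->
  map_mpoly f (\sum_(a <- msupp p) g p@_a *: 'X_[a]) = p.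
Proof.
move=> gK; rewrite raddf_sum [RHS]mpolyE; apply: eq_big_seq => a ap /=.
by rewrite map_mpolyZ map_mpolyX gK //; apply: map_f.
Qed.

(* Ax's argument: over a finite field an injective polynomial map is onto. *)
Lemma certified_surj (K : fieldType) m (p : 'I_m -> {mpoly K[m]}) Q (al be : {mpoly K[m]})
    (y : 'I_m -> K) i :
  [pchar K] =i pred0 -> certified p Q ->
  mmap (@mpolyC m K) p be * 'X_i = mmap (@mpolyC m K) p al -> be.@[y] = 0 -> al.@[y] = 0.
Proof.
move=> K0 cpQ e_ab be0; apply/eqP; apply: contraT => al0.
(* All scalars occurring in the data. They lie in the image of [T]; [g] picks preimages and [L]
   lifts polynomials coefficientwise. *)
pose s := flatten [seq coefs (p j) | j <- enum 'I_m]
  ++ (flatten [seq coefs (Q u.1 u.2) | u <- enum {: 'I_m * 'I_m}]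
  ++ (coefs al ++ (coefs be ++ codom y))).
have [T [zeta [sp im]]] := ex_specializable s K0.
have exg x : exists t, x \in s -> zeta t = x.
  case: (boolP (x \in s)) => [/im[t <-]|xs]; first by exists t.
  by exists 0.
have {exg}[g gK] := boolp.choice exg.
pose L n (q : {mpoly K[n]}) := \sum_(a <- msupp q) g q@_a *: 'X_[a] : {mpoly T[n]}.
have LK n (q : {mpoly K[n]}) : {subset coefs q <= s} -> map_mpoly zeta (L n q) = q.
  by move=> qs; apply: coefs_lift => c /qs/gK.
have Lp j : map_mpoly zeta (L _ (p j)) = p j.
  apply: LK => c cp; rewrite mem_cat; apply/orP; left.
  by apply/flatten_mapP; exists j => //; rewrite mem_enum.
have LQ i1 j : map_mpoly zeta (L _ (Q i1 j)) = Q i1 j.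
  apply: LK => c cp; rewrite 2!mem_cat; apply/orP; right; apply/orP; left.
  by apply/flatten_mapP; exists (i1, j) => //; rewrite mem_enum.
have Lal : map_mpoly zeta (L _ al) = al.
  by apply: LK => c cp; rewrite !mem_cat cp !orbT.
have Lbe : map_mpoly zeta (L _ be) = be.
  by apply: LK => c cp; rewrite !mem_cat cp !orbT.
have Ly j : zeta (g (y j)) = y j.
  by apply: gK; rewrite !mem_cat codom_f !orbT.
have ev q : zeta (L m q).@[g \o y] = (map_mpoly zeta (L m q)).@[y].
  by rewrite [LHS]mmap_morph [RHS]mmap_map; apply: eq_mmap => // j; apply: Ly.
have [k [om [kerom omal]]] : exists (k : finFieldType) (om : {rmorphism T -> k}),
    (forall f, zeta f = 0 -> om f = 0) /\ om (L m al).@[g \o y] != 0.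
  by apply: sp; rewrite ev Lal.
(* Every polynomial identity over [K] between lifted data thus passes to [k], in particular the
   certificate and the relation between [al] and [be]. *)
have kermap n (q : {mpoly T[n]}) : map_mpoly zeta q = 0 -> map_mpoly om q = 0.
  move=> q0; apply/mpolyP=> a; rewrite mcoeff_map_mpoly mcoeff0; apply: kerom.
  by rewrite -mcoeff_map_mpoly q0 mcoeff0.
pose pk j := map_mpoly om (L m (p j)); pose Qk i1 j := map_mpoly om (L _ (Q i1 j)).
have cpk : certified pk Qk.
  move=> j; rewrite -cert_defect_map; apply: kermap; rewrite cert_defect_map.
  rewrite -[RHS](cpQ j) /cert_defect; congr (_ - _); apply: eq_bigr => l _.
  by rewrite LQ Lp.
pose F (X : {ffun 'I_m -> k}) := [ffun j => (pk j).@[X]].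
have injF : injective F.
  move=> X X' eF; apply/ffunP=> j; apply/eqP; rewrite -subr_eq0; apply/eqP.
  rewrite (certified_eval idfun X X' j cpk) big1 // => l _.
  by move/ffunP/(_ l): eF; rewrite !ffunE /meval => ->; rewrite subrr mulr0.
have [G _ GK] := injF_bij injF.
pose yk := [ffun j => om (g (y j))]; pose X := G yk.
have FX j : (pk j).@[X] = om (g (y j)).
  by have /ffunP/(_ j) := GK yk; rewrite !ffunE.
have evk q : (mmap (@mpolyC m k) pk (map_mpoly om q)).@[X] = om q.@[g \o y].
  rewrite [LHS]mmap_morph [LHS]mmap_map [RHS]mmap_morph; apply: eq_mmap => j /=.
    by rewrite mevalC.
  exact: FX.
have mapc (q : {mpoly T[m]}) (S : comNzRingType) (f : {rmorphism T -> S}) :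
    map_mpoly f (mmap (@mpolyC m T) (fun j => L m (p j)) q) =
    mmap (@mpolyC m S) (fun j => map_mpoly f (L m (p j))) (map_mpoly f q).
  by rewrite mmap_morph mmap_map; apply: eq_mmap => [c|j] //=; rewrite map_mpolyC.
have ek : mmap (@mpolyC m k) pk (map_mpoly om (L m be)) * 'X_i
    = mmap (@mpolyC m k) pk (map_mpoly om (L m al)).
  apply/eqP; rewrite -subr_eq0 -!mapc -(map_mpolyX om) -rmorphM -rmorphB.
  apply/eqP; apply: kermap; rewrite rmorphB rmorphM /= !mapc map_mpolyX Lal Lbe.
  rewrite (eq_mmap (frefl _) Lp) (eq_mmap (frefl _) Lp).
  by apply/eqP; rewrite subr_eq0; apply/eqP.
(* Since [pk] maps [X] to the reduction of [y], the relation at [X] says that the reduction of [be]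
   at [y], which is 0, times [X i] equals that of [al] at [y], which is not 0. *)
have := congr1 (meval X) ek; rewrite mevalM !evk (kerom (L m be).@[_]) ?mul0r.
  by move/eqP; rewrite eq_sym (negPf omal).
by rewrite ev Lbe.
Qed.

(** * Linear functionals over a subfield, and rationality of the inverse *)

Lemma subfield_functional (L : fieldType) (F : L -> Prop) (x : L) :
  F 1 -> (forall u v, F u -> F v -> F (u - v)) -> (forall u v, F u -> F v -> F (u * v)) ->
  (forall u, F u -> F u^-1) -> ~ F x ->
  exists lam : L -> L, [/\ forall u v, lam (u + v) = lam u + lam v,
    forall c u, F c -> lam (c * u) = c * lam u, lam 1 = 0 & lam x = 1].
Proof.
move=> F1 FB FM FV Fx.
have F0 : F 0 by rewrite -(subrr 1); apply: FB.
have FN u : F u -> F (- u) by move=> Fu; rewrite -sub0r; apply: FB.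
have FD u v : F u -> F v -> F (u + v) by move=> Fu Fv; rewrite -[v]opprK; apply/FB/FN.
(* A maximal [F]-subspace containing 1 but not [x] is a complement of the line [F x]; [lam] reads
   off the coefficient of [x]. *)
pose good (H : L -> Prop) := [/\ H 0, H 1, forall u v, H u -> H v -> H (u + v),
  forall c u, F c -> H u -> H (c * u) & ~ H x].
(* The union of the empty chain is empty, so the empty set must satisfy [P]; hence goodness is
   demanded of inhabited sets only. *)
pose P (H : L -> Prop) := forall h, H h -> good H.
have [] := @classical_sets.Zorn_bigcup L P.
  move=> G GP totG h [X GX Xh].
  have gX Y : G Y -> forall y, Y y -> good Y by move=> /GP PY y /PY.
  have [X0 X1 _ _ _] := gX _ GX _ Xh.
  split; [by exists X|by exists X| | |].
  - move=> u v [Y GY Yu] [Z GZ Zv]; have [sYZ|sZY] := totG _ _ GY GZ.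
      by exists Z => //; have [_ _ ZD _ _] := gX _ GZ _ Zv; apply: ZD => //; apply: sYZ.
    by exists Y => //; have [_ _ YD _ _] := gX _ GY _ Yu; apply: YD => //; apply: sZY.
  - move=> c u Fc [Y GY Yu]; exists Y => //.
    by have [_ _ _ YM _] := gX _ GY _ Yu; apply: YM.
  - by move=> [Y GY Yx]; have [_ _ _ _] := gX _ GY _ Yx.
move=> A [PA maxA].
have Agood : good A.
  have [[h Ah]|nA] := boolp.pselect (exists h, A h); first exact: PA Ah.
  case: (maxA F); last by move=> h _; split.
  split; first by move=> h Ah; case: nA; exists h.
  by move=> /(_ 0 F0) A0; apply: nA; exists 0.
have [A0 A1 AD AM Ax] := Agood.
have decomp z : exists hc : L * L, [/\ A hc.1, F hc.2 & z = hc.1 + hc.2 * x].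
  have [Az|nAz] := boolp.pselect (A z); first by exists (z, 0); rewrite mul0r addr0.
  (* For [z] outside [A], the larger subspace [A + F z] must contain [x] by maximality; then solve
     for [z]. *)
  pose B y := exists hc : L * L, [/\ A hc.1, F hc.2 & y = hc.1 + hc.2 * z].
  have [[[h c] [/= Ah Fc eq_x]]|nBx] := boolp.pselect (B x).
    have c0 : c != 0 by apply: contra_notN Ax => /eqP c0; rewrite eq_x c0 mul0r addr0.
    exists (- c^-1 * h, c^-1); split=> /=; [|exact: FV|].
      by apply: AM => //; apply/FN/FV.
    by rewrite eq_x mulrDr mulrA mulVf // mul1r addrA mulNr addNr add0r.
  case: (maxA B); [split|].
  - by move=> y Ay; exists (y, 0); rewrite mul0r addr0.
  - by move=> /(_ z); apply: contra_not nAz; apply; exists (0, 1); rewrite mul1r add0r.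
  move=> _ _; split=> //.
  - by exists (0, 0); rewrite mul0r addr0.
  - by exists (1, 0); rewrite mul0r addr0.
  - move=> _ _ [[h c] [/= Ah Fc ->]] [[h' c'] [/= Ah' Fc' ->]].
    exists (h + h', c + c'); split=> /=; [exact: AD|exact: FD|].
    by rewrite mulrDl addrACA.
  - move=> d _ Fd [[h c] [/= Ah Fc ->]]; exists (d * h, d * c).
    by split=> /=; [exact: AM|exact: FM|rewrite mulrDr mulrA].
have [f fP] := boolp.choice decomp.
have uniq h c h' c' : A h -> F c -> A h' -> F c' -> h + c * x = h' + c' * x -> c = c'.
  move=> Ah Fc Ah' Fc' e; apply/eqP; rewrite -subr_eq0; apply: contra_notT Ax => d0.
  have -> : x = (c - c')^-1 * (h' + -1 * h).
    apply: (mulfI d0); rewrite mulrA divff // mul1r mulrBl mulN1r.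
    by apply/eqP; rewrite subr_eq addrAC -e addrAC subrr add0r.
  by apply: (AM); [apply/FV/FB|apply: (AD) => //; apply: (AM) => //; apply: FN].
have lamE h c : A h -> F c -> (f (h + c * x)).2 = c.
  by move=> Ah Fc; have [Af Ff e] := fP (h + c * x); apply: uniq Af Ff Ah Fc (esym e).
exists (fun z => (f z).2); split.
- move=> u v; have [Au Fu eu] := fP u; have [Av Fv ev] := fP v.
  rewrite {1}eu {1}ev addrACA -mulrDl lamE //; [exact: AD|exact: FD].
- move=> c u Fc; have [Au Fu eu] := fP u.
  rewrite {1}eu mulrDr mulrA lamE //; [exact: AM|exact: FM].
- by have := lamE 1 0 A1 F0; rewrite mul0r addr0.
- by have := lamE 0 1 A0 F1; rewrite mul1r add0r.
Qed.

Section LinearExtension.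
Variables (n : nat) (R : nzRingType) (mu : 'X_{1..n} -> R).
Definition linext (p : {mpoly R[n]}) := \sum_(a <- msupp p) p@_a * mu a.

(** An index set that depends only on a degree bound lets sums for different polynomials be compared
    term by term. *)
Lemma linextE p k : (msize p <= k)%N ->
  linext p = \sum_(a : 'X_{1..n < k}) p@_a * mu a.
Proof.
move=> le_k; pose I : subFinType _ := 'X_{1..n < k}.
rewrite /linext (big_mksub I) ?msupp_uniq //=; first last.
  by move=> a /msize_mdeg_lt /leq_trans; apply.
rewrite big_rmcond //= => a; rewrite -mcoeff_eq0 => /eqP ->.
by rewrite mul0r.
Qed.

Lemma linext_is_additive : additive linext.
Proof.
move=> p q; pose k := maxn (msize (p - q)) (maxn (msize p) (msize q)).
rewrite !(@linextE _ k) ?leq_max ?leqnn ?orbT // -sumrB; apply: eq_bigr => a _.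
by rewrite mcoeffB mulrBl.
Qed.
HB.instance Definition _ := GRing.isAdditive.Build {mpoly R[n]} R linext linext_is_additive.

Lemma linextZX c a : linext (c *: 'X_[a]) = c * mu a.
Proof.
rewrite (@linextE _ (mdeg a).+1); last by rewrite (leq_trans (msizeZ_le _ _)) // msizeX.
rewrite (bigD1 (BMultinom (ltnSn (mdeg a)))) //= mcoeffZ mcoeffX eqxx mulr1.
rewrite big1 ?addr0 // => b ne_b; rewrite mcoeffZ mcoeffX.
case: eqP => [e|_]; last by rewrite mulr0 mul0r.
by case/eqP: ne_b; apply: val_inj.
Qed.
End LinearExtension.

Notation compm p := (mmap (@mpolyC _ _) p).

Lemma mmap1M n (R : comNzRingType) (h : 'I_n -> R) a b :
  mmap1 h (a + b)%MM = mmap1 h a * mmap1 h b.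
Proof.
rewrite /mmap1 -big_split; apply: eq_bigr => i _ /=.
by rewrite mnmDE exprD.
Qed.

(* Certification makes x (x) 1 = 1 (x) x in L (x)_F L, where L is the field of rational
   functions and F its subfield generated by p: applying lam (x) id, for an F-linear lam
   with lam 1 = 0, gives lam x = 0. *)
Lemma certified_rational (K : fieldType) m (p : 'I_m -> {mpoly K[m]}) Q i :
  certified p Q -> exists a b : {mpoly K[m]},
    compm p b != 0 /\ compm p b * 'X_i = compm p a.
Proof.
move=> cpQ; pose L := {fraction {mpoly K[m]}}.
pose F (z : L) := exists a b : {mpoly K[m]},
  compm p b != 0 /\ z = tofrac (compm p a) / tofrac (compm p b).
pose xi j : L := tofrac 'X_j.
have [[a [b [b0 e]]]|nF] := boolp.pselect (F (xi i)).
  exists a, b; split=> //; apply/eqP; rewrite -tofrac_eq; apply/eqP.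
  by rewrite rmorphM /= -/(xi i) e mulrC divfK // tofrac_eq0.
have Fc c : F (tofrac (compm p c)).
  by exists c, 1; rewrite !rmorph1 oner_eq0 divr1.
have [|||u|lam [lamD lamM lam1 lamx]] := subfield_functional _ _ _ _ nF.
- by have := Fc 1; rewrite !rmorph1.
- move=> u v [a [b [b0 ->]]] [a' [b' [b'0 ->]]].
  exists (a * b' - a' * b), (b * b'); rewrite !rmorphM rmorphB !rmorphM /= mulf_neq0 //.
  split=> //; rewrite rmorphB !rmorphM /= mulrBl; congr (_ - _).
    by rewrite -mulf_div divff ?mulr1 // tofrac_eq0.
  by rewrite [_ * tofrac (compm p b')]mulrC -mulf_div divff ?mulr1 // tofrac_eq0.
- move=> u v [a [b [b0 ->]]] [a' [b' [b'0 ->]]].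
  exists (a * a'), (b * b'); rewrite !rmorphM /= mulf_neq0 //.
  by rewrite mulf_div.
- move=> [a [b [b0 ->]]]; have [a0|a0] := eqVneq (compm p a) 0.
    by exists 0, 1; rewrite rmorph1 oner_eq0 !rmorph0 a0 rmorph0 !mul0r invr0.
  by exists b, a; rewrite invf_div.
have lam0 : lam 0 = 0 by apply: (addrI (lam 0)); rewrite -lamD !addr0.
have lam_sum I (r : seq I) (f : I -> L) : lam (\sum_(k <- r) f k) = \sum_(k <- r) lam (f k).
  by apply: (big_morph lam lamD lam0).
pose iota : {rmorphism K -> L} := @tofrac {mpoly K[m]} \o @mpolyC m K.
have FC c : F (iota c).
  by have := Fc c%:MP; rewrite mmapC.
have xiE q : mmap iota xi q = tofrac q.
  by rewrite -[in RHS](mmap_id q) mmap_morph.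
(* This is [lam] (x) id: the variables of [{mpoly L[m]}] stand for the left tensor factor and the
   coefficients for the right one. *)
pose Psi : {additive {mpoly L[m]} -> L} := linext (fun a => lam (mmap1 xi a)).
(* [F]-linearity of [lam] moves [p j] from one factor to the other. *)
have Psi_p j (q : {mpoly L[m]}) :
    Psi (q * (map_mpoly iota (p j) - (tofrac (p j))%:MP)) = 0.
  rewrite [q]mpolyE mulr_suml raddf_sum big1 // => a _.
  rewrite mulrBr raddfB /= [map_mpoly _ _]mpolyE mulr_sumr raddf_sum /=.
  apply/eqP; rewrite subr_eq0; apply/eqP.
  rewrite mulrC mul_mpolyC scalerA /Psi /= linextZX.
  have -> : tofrac (p j) * q@_a * lam (mmap1 xi a) = q@_a * lam (tofrac (p j) * mmap1 xi a).
    rewrite lamM; first by rewrite mulrCA mulrA.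
    by have := Fc 'X_j; rewrite mmapU.
  rewrite -(xiE (p j)) /mmap mulr_suml lam_sum mulr_sumr.
  transitivity (\sum_(b <- msupp (map_mpoly iota (p j)))
      q@_a * lam ((map_mpoly iota (p j))@_b * mmap1 xi b * mmap1 xi a)).
    apply: eq_bigr => b _; rewrite -scalerAl -scalerAr scalerA -mpolyXD linextZX.
    rewrite mcoeff_map_mpoly -!mulrA (lamM _ _ (FC _)) /= mmap1M.
    by rewrite [mmap1 xi a * _]mulrC.
  rewrite (perm_big _ (msupp_map_mpoly _ _)) /=; last exact: fmorph_inj.
  by apply: eq_bigr => b _; rewrite mcoeff_map_mpoly.
(* The certificate is evaluated at the pair of left and right generic points. [Psi] kills its right
   side, while its left side goes to [lam (xi i) - xi i * lam 1 = 1]. *)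
have := certified_eval (@mpolyC m L \o iota) (fun j => 'X_j) (fun j => (xi j)%:MP) i cpQ.
move/(congr1 Psi); rewrite raddf_sum big1 => [|j _]; last first.
  have Psi_pj := Psi_p j (mmap (@mpolyC m L \o iota)
    (catf (fun j => 'X_j) (fun j => (xi j)%:MP)) (Q i j)).
  rewrite -[RHS]Psi_pj; congr (Psi (_ * (_ - _))).
  by rewrite -(xiE (p j)) mmap_morph.
rewrite raddfB /= -[X in linext _ X]scale1r linextZX mmap1U lamx mulr1.
rewrite -[(xi i)%:MP]mulr1 mul_mpolyC -mpolyX0 linextZX mmap11 lam1 mulr0 subr0.
by move/eqP; rewrite oner_eq0.
Qed.

(** * The polynomial inverse *)

Lemma hmorph_morph (T K S : comNzRingType) (g : {rmorphism K -> S}) (f : {rmorphism T -> K})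
    (f' : {rmorphism T -> S}) z p :
  (forall c, g (f c) = f' c) -> g (hmorph f z p) = hmorph f' (g z) p.
Proof.
move=> ef; rewrite !hmorphE -horner_map -map_poly_comp /=; congr _.[_].
by apply: eq_map_poly => c; apply: ef.
Qed.

Local Notation widen := (widen_ord (leqnSn _)).

Lemma closed_nonroot (C : closedFieldType) (p : {poly C}) : p != 0 -> exists x, p.[x] != 0.
Proof.
(* At a root [x] of this polynomial, [x * p.[x] = 1]. *)
move=> p0; have /closed_rootP[x] : size ('X * p - 1) != 1%N.
  rewrite mulrC size_polyDl size_mulX // ?size_polyN ?size_poly1 ?ltnS ?size_poly_gt0 //.
  by rewrite eqSS size_poly_eq0.
rewrite rootE !hornerE subr_eq0 => /eqP xp; exists x.
by apply: contra_eq_neq xp => ->; rewrite mulr0 eq_sym oner_eq0.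
Qed.

Lemma muni_eq0 n (R : nzRingType) (p : {mpoly R[n.+1]}) : muni p = 0 -> p = 0.
Proof.
move=> p0; apply/mpolyP=> a; rewrite mcoeff0; apply/eqP; rewrite -[_ == 0]negbK -mcoeff_msupp.
apply/negP=> ap; move: (ap); rewrite mcoeff_msupp => /eqP; apply.
pose r (b : 'X_{1..n.+1}) : 'X_{1..n} := [multinom (b (widen i)) | i < n].
have := congr1 (fun q : {poly {mpoly R[n]}} => (q`_(a ord_max))@_(r a)) p0.
rewrite muniE coef0 mcoeff0 coef_sum raddf_sum /= (bigD1_seq a) //= big1 => [|b ne_ba].
  by rewrite addr0 coefZ coefXn eqxx mulr1 mcoeffZ mcoeffX eqxx mulr1.
rewrite coefZ coefXn; case: eqP => [e|]; last by rewrite mulr0 mcoeff0.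
rewrite mulr1 mcoeffZ mcoeffX; case: eqP => [er|]; last by rewrite mulr0.
case/eqP: ne_ba; apply/mnmP=> i; case: (unliftP ord_max i) => [j ->|->]; last by rewrite e.
have := congr1 (fun c : 'X_{1..n} => c j) er; rewrite !mnmE.
have -> : lift ord_max j = widen j by apply: val_inj; rewrite /= /bump leqNgt ltn_ord.
by [].
Qed.

(** Induction on [n]: first avoid the zeros of the leading coefficient in the last variable, then
    those of the remaining univariate polynomial. *)
Lemma mpoly_nonroot (C : closedFieldType) n (p : {mpoly C[n]}) :
  p != 0 -> exists x, p.@[x] != 0.
Proof.
elim: n p => [|n IHn] p p0.
  exists (fun=> 0); rewrite -[p]mpolyKC mevalC.
  by apply: contraNneq p0 => e; apply/eqP; rewrite -[LHS]mpolyKC e mpolyC0.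
have up0 : muni p != 0 by apply: contraNneq p0 => /muni_eq0 ->.
have [x xl] := IHn (lead_coef (muni p)) ltac:(by rewrite lead_coef_eq0).
have [|t pt] := @closed_nonroot C (map_poly (meval x) (muni p)).
  by rewrite -lead_coef_eq0 lead_coef_map_eq.
(* The point is described as the image of the variables under the evaluation morphism, so that
   evaluation at it is that morphism. *)
exists (fun i => hmorph (meval x) t (muni 'X_i)).
pose g : {rmorphism {mpoly C[n.+1]} -> C} := hmorph (meval x) t \o @muni n C.
suff -> : p.@[fun i => g 'X_i] = g p by [].
have <- : g (mmap (@mpolyC _ C) (fun i => 'X_i) p) = g p by rewrite (mmap_id p).
rewrite (mmap_morph g); apply: eq_mmap => // c.
rewrite -[RHS]/(hmorph (meval x) t (muni c%:MP)) muniC hmorphC.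
by rewrite /= mevalC.
Qed.

(** A unit constant term makes [b] invertible as a power series, so divisibility by [c] passes from
    [q * b] to [q], one coefficient at a time. *)
Lemma dvd_unit_coef0 (R : comNzRingType) (c : R) (q b : {poly R}) (a : {poly R}) u :
  u * b`_0 = 1 -> q * b = c *: a -> exists q', q = c *: q'.
Proof.
move=> ub e; suff H k : exists d, q`_k = c * d.
  have [g gP] := boolp.choice H; exists (\poly_(k < size q) g k).
  apply/polyP=> k; rewrite coefZ coef_poly; case: ltnP => // le_k.
  by rewrite mulr0 nth_default.
elim/ltn_ind: k => k IH; have [g gP] := boolp.choice (fun j : 'I_k => IH j (ltn_ord j)).
have := congr1 (fun p : {poly R} => p`_k) e; rewrite coefM coefZ big_ord_recr /= subnn => ek.
exists (u * (a`_k - \sum_(j < k) g j * b`_(k - j))).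
rewrite mulrCA mulrBr -ek mulr_sumr -[LHS]mulr1 -ub.
under [X in _ + _ - X]eq_bigr => j _ do rewrite mulrA -gP.
by rewrite addrAC subrr add0r mulrCA.
Qed.

(** The fraction [f / g] in lowest terms over the fraction field of [R], with a Bezout relation, all
    cleared of denominators. Since [g] does not divide [f], the reduced denominator [q2] is not
    constant. *)
Lemma coprime_reduction (R : idomainType) (f g : {poly R}) : g != 0 -> ~~ (g %| f) ->
  exists d q1 q2 c1 c2 u v r, [/\ [/\ d != 0, c1 != 0, c2 != 0 & r != 0],
    c1 *: f = q1 * d /\ c2 *: g = q2 * d, (1 < size q2)%N & u * q1 + v * q2 = r%:P].
Proof.
move=> g0 ndvd; pose d := gcdp f g.
have d0 : d != 0 by rewrite gcdp_eq0 (negPf g0) andbF.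
have /Pdiv.Idomain.dvdpP[[c1 q1] /= c10 e1] : d %| f by apply: dvdp_gcdl.
have /Pdiv.Idomain.dvdpP[[c2 q2] /= c20 e2] : d %| g by apply: dvdp_gcdr.
have [[u v] /= /Pdiv.Idomain.eqpP[[f1 f2] /= /andP[f10 f20] ef]] := Bezoutp f g.
have q20 : q2 != 0.
  apply: contraNneq g0 => q20; move/eqP: e2.
  by rewrite q20 mul0r scale_poly_eq0 (negPf c20).
exists d, q1, q2, c1, c2, ((f1 * c2) *: u), ((f1 * c1) *: v), (f2 * (c1 * c2)); split=> //.
- by rewrite !mulf_neq0.
- rewrite ltnNge; apply: contra ndvd => /size1_polyC q2C.
  apply: (@dvdp_trans _ d); last exact: dvdp_gcdl.
  apply/Pdiv.Idomain.dvdpP; exists (q2`_0, c2%:P) => /=.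
    by move: q20; rewrite {1}q2C polyC_eq0.
  by rewrite mul_polyC e2 {2}q2C mul_polyC.
apply: (mulIf d0); rewrite mulrDl -!scalerAl -!mulrA -e1 -e2 -!scalerAr !scalerA.
rewrite mul_polyC; move/(congr1 (fun z => (c1 * c2) *: z)): ef.
rewrite !scalerA [in RHS]mulrC -/d => <-; rewrite scalerDr.
by congr (_ *: _ + _ *: _); ring.
Qed.

Lemma cross_fraction (R : idomainType) (c1 c2 q1 q2 d a b x : R) : d != 0 ->
  c1 * a = q1 * d -> c2 * b = q2 * d -> b * x = a -> c1 * q2 * x = c2 * q1.
Proof.
move=> d0 e1 e2 e; apply: (mulIf d0).
have -> : c1 * q2 * x * d = c1 * (q2 * d) * x by ring.
by rewrite -e2 -(mulrA c2) -e1 -e; ring.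
Qed.

Section Inverse.
Variables (C : closedFieldType) (m : nat) (p : 'I_m -> {mpoly C[m]}).
Variable Q : 'I_m -> 'I_m -> {mpoly C[m + m]}.
Hypotheses (C0 : [pchar C] =i pred0) (cpQ : certified p Q).

(** Algebraic independence of [p], from [certified_surj] with zero denominator. That lemma needs an
    index [i], so [m = 0] is treated apart. *)
Lemma certified_independent al (y : 'I_m -> C) : compm p al = 0 -> al.@[y] = 0.
Proof.
move=> al0; have [i|m0] := pickP 'I_m.
  move=> _; apply: (@certified_surj _ _ p Q al 0 y i) => //; last by rewrite meval0.
  by rewrite rmorph0 mul0r al0.
suff -> : al = 0 by rewrite meval0.
rewrite -al0 -[LHS]mmap_id; apply: eq_mmap => // j.
by have := m0 j.
Qed.

(* Restricting to the line w + t v with v generic makes the denominator b a polynomial in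
   one variable.  A pole at t0 would contradict certified_surj; a denominator that is
   regular at t = 0 and has no pole is trivial. *)
Lemma certified_inverse i : exists F : {mpoly C[m]}, compm p F = 'X_i.
Proof.
have [a [b [b0 eab]]] := certified_rational i cpQ.
have [x0 bx0] := mpoly_nonroot b0.
pose w j := (p j).@[x0].
have bw : b.@[w] != 0.
  apply: contraNneq bx0 => bw; rewrite [X in X == _]mmap_morph -[X in _ == X]bw.
  by apply/eqP/eq_mmap => // c /=; rewrite mevalC.
pose R := {mpoly C[m]}.
pose kR : {rmorphism C -> {poly R}} := polyC \o @mpolyC m C.
(* The outer variable ['X] is the parameter t and the ['X_j] are the coordinates of the generic
   direction v. The base point [w] is a value of [p] at which [b] is nonzero. *)
pose line : {rmorphism {mpoly C[m]} -> {poly R}} :=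
  mmap kR (fun j => (w j)%:MP%:P + 'X * ('X_j)%:P).
have lineE (S : comNzRingType) (f : {rmorphism R -> S}) z (h : 'I_m -> S) g :
    (forall j, h j = f (w j)%:MP + z * f 'X_j) ->
    hmorph f z (line g) = mmap (f \o @mpolyC m C) h g.
  move=> hE; rewrite /line mmap_morph; apply: eq_mmap => [c|j] /=.
    by rewrite hmorphC.
  by rewrite hmorphD hmorphM !hmorphC hmorphX hE.
have line0 g : (line g)`_0 = (g.@[w])%:MP.
  have /= := @lineE R idfun 0 (fun j => (w j)%:MP) g (fun j => _).
  rewrite hmorphE map_poly_id // horner_coef0 => ->; last by move=> j; rewrite mul0r addr0.
  by rewrite mmap_morph; apply: eq_mmap.
pose at_ := line a; pose bt := line b.
have bt0 : bt != 0.
  apply: contraNneq bw => e; have := line0 b.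
  by rewrite -/bt e coef0 => /esym/eqP; rewrite mpolyC_eq0.
(* Without a pole the quotient lies in [{poly R}], because [bt] has the unit constant term [b.@[w]].
   Setting t = 1 and v = y - w in it gives the polynomial inverse. *)
have [|ndvd] := boolP (bt %| at_).
  case/Pdiv.Idomain.dvdpP => [[c q]] /= c0 ecq.
  have ub : ((b.@[w])^-1)%:MP * bt`_0 = 1 by rewrite line0 -rmorphM mulVf // rmorph1.
  have [q' eq'] := dvd_unit_coef0 ub (esym ecq).
  have ea : at_ = q' * bt.
    move: ecq; rewrite eq' -scalerAl => /eqP.
    by rewrite -subr_eq0 -scalerBr scale_poly_eq0 (negPf c0) /= subr_eq0 => /eqP.
  pose G0 : {rmorphism R -> R} := compm (fun j => 'X_j - (w j)%:MP).
  pose G1 : {rmorphism R -> R} := compm (fun j => p j - (w j)%:MP).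
  have pG c1 : compm p (G0 c1) = G1 c1.
    rewrite /G0 mmap_morph; apply: eq_mmap => [d|j] /=; first by rewrite mmapC.
    by rewrite rmorphB /= mmapU mmapC.
  have lineG g : hmorph G1 1 (line g) = compm p g.
    rewrite (lineE _ G1 1 p) => [|j]; first by apply: eq_mmap => // c1; apply: mmapC.
    by rewrite /G1 /= mmapC mmapU mul1r addrC subrK.
  exists (hmorph G0 1 q'); rewrite (hmorph_morph 1 q' pG) rmorph1.
  apply: (mulfI b0); rewrite eab -!lineG -hmorphM -/at_ ea mulrC.
  by [].
exfalso.
have [d [q1 [q2 [c1 [c2 [u [v [r [[d0 c10 c20 r0] [e1 e2] szq2 bez]]]]]]]]] :=
  coprime_reduction bt0 ndvd.
have q20 : q2 != 0 by rewrite -size_poly_gt0 ltnW.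
(* A direction in which the reduced denominator keeps its degree, hence has a root [t0], and the
   Bezout constant stays nonzero. *)
have [v0] : exists v0, (lead_coef q2 * (r * c2)).@[v0] != 0.
  by apply: mpoly_nonroot; rewrite !mulf_neq0 // lead_coef_eq0.
rewrite !mevalM !mulf_eq0 !negb_or => /and3P[lq2v rv c2v].
have szq2v : size (map_poly (meval v0) q2) = size q2 by rewrite size_poly_eq.
have /closed_rootP[t0] : size (map_poly (meval v0) q2) != 1%N.
  by rewrite szq2v; case: (size q2) szq2 => [|[]].
move=> /rootP q2t.
have t00 : t0 != 0.
  apply: contraNneq bw => t00.
  have := congr1 (hmorph (meval v0) 0) e2; rewrite hmorphZ hmorphM [hmorph _ _ q2]hmorphE -t00 q2t.
  rewrite mul0r => /eqP; rewrite mulf_eq0 (negPf c2v) /= hmorphE t00 horner_coef0 coef_map line0.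
  by rewrite /= mevalC.
pose y0 j := w j + t0 * v0 j.
(* With t fixed at [t0], the direction is recovered as v = (y - w) / t0. So [S] undoes [line], and
   at the pole [y0] it specializes v to [v0]. *)
pose S0 : {rmorphism R -> R} := compm (fun j => t0^-1 *: ('X_j - (w j)%:MP)).
pose S : {rmorphism {poly R} -> R} := hmorph S0 t0%:MP.
have Sline g : S (line g) = g.
  rewrite -[LHS]/(hmorph S0 t0%:MP (line g)) (lineE _ S0 _ (fun j => 'X_j)) => [|j].
    by rewrite -[RHS]mmap_id; apply: eq_mmap => // c; apply: mmapC.
  rewrite /S0 /= mmapC mmapU -mul_mpolyC mulrA -rmorphM mulfV // rmorph1 mul1r.
  by rewrite addrC subrK.
have Sy g : (S g).@[y0] = hmorph (meval v0) t0 g.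
  rewrite -[S g]/(hmorph S0 t0%:MP g).
  rewrite (@hmorph_morph _ _ _ (meval y0) S0 (meval v0)) => [|c] /=; first by rewrite mevalC.
  rewrite /S0 [LHS]mmap_morph; apply: eq_mmap => [c'|j] /=; first by rewrite mevalC.
  by rewrite mevalZ mevalB mevalXU mevalC /y0 addrAC subrr add0r mulrA mulVf // mul1r.
have Sc c : (S c%:P).@[y0] = c.@[v0] by rewrite Sy hmorphC.
pose T : {rmorphism {poly R} -> R} := compm p \o S.
have TM f g : T (f * g) = T f * T g by apply: (rmorphM T).
have TE g : T (line g) = compm p g := congr1 (compm p) (Sline g).
have T1 : T c1%:P * compm p a = T q1 * T d.
  by have := congr1 T e1; rewrite -mul_polyC (TM c1%:P) (TM q1) TE.
have T2 : T c2%:P * compm p b = T q2 * T d.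
  by have := congr1 T e2; rewrite -mul_polyC (TM c2%:P) (TM q2) TE.
have Tc2 : T c2%:P != 0.
  apply: contraNneq c2v => /(certified_independent y0).
  by rewrite Sc => ->.
have Td : T d != 0.
  apply: contraTneq (mulf_neq0 Tc2 b0) => Td; rewrite negbK T2 Td mulr0; exact: eqxx.
(* By [certified_surj], the vanishing of [q2] at the pole forces that of [q1], against the Bezout
   relation. *)
have key : T (c1%:P * q2) * 'X_i = T (c2%:P * q1).
  by rewrite !TM; apply: cross_fraction Td T1 T2 eab.
have := certified_surj (y := y0) C0 cpQ key.
rewrite !Sy !hmorphM !hmorphC !hmorphE q2t mulr0 => /(_ erefl)/eqP.
rewrite mulf_eq0 (negPf c2v) /= => /eqP q1t.
have := congr1 (hmorph (meval v0) t0) bez.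
rewrite hmorphD !hmorphM ![hmorph _ _ q1]hmorphE ![hmorph _ _ q2]hmorphE q1t q2t.
rewrite !mulr0 addr0 hmorphC => /esym/eqP.
by rewrite (negPf rv).
Qed.
End Inverse.

(** * Free polynomial maps at a fixed level *)

Fixpoint ncmap N (R S : Type) (f : R -> S) (p : ncpoly N R) : ncpoly N S :=
  match p with
  | NCVar i => NCVar i
  | NCConst c => NCConst (f c)
  | NCAdd p q => NCAdd (ncmap f p) (ncmap f q)
  | NCMul p q => NCMul (ncmap f p) (ncmap f q)
  end.

Definition mapX (R S : Type) N n k (f : R -> S) (X : {ffun 'I_N -> 'M[R]_(n, k)}) :=
  [ffun i => map_mx f (X i)].

Lemma ncmap_comp N (R S T : Type) (f : S -> T) (g : R -> S) (h : R -> T) (p : ncpoly N R) :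
  (forall c, f (g c) = h c) -> ncmap f (ncmap g p) = ncmap h p.
Proof. by move=> e; elim: p => //= [c|p -> q ->|p -> q ->]; rewrite ?e. Qed.

Lemma ncmap_id N (R : Type) (p : ncpoly N R) : ncmap id p = p.
Proof. by elim: p => //= [p -> q ->|p -> q ->]. Qed.

Lemma nceval_map N n (R S : comNzRingType) (f : {rmorphism R -> S}) (p : ncpoly N R)
    (X : {ffun 'I_N -> 'M[R]_n}) :
  map_mx f (nceval p X) = nceval (ncmap f p) (mapX f X).
Proof.
elim: p => /= [i|c|p IHp q IHq|p IHp q IHq]; first by rewrite ffunE.
- exact: map_scalar_mx.
- by rewrite map_mxD IHp IHq.
- by rewrite map_mxM IHp IHq.
Qed.

Section Derivative.
Variables (N n : nat) (R : comNzRingType).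
Implicit Types (X H : {ffun 'I_N -> 'M[R]_n}) (p : ncpoly N R).

(** The noncommutative difference-differential operator: [X] is substituted to the left of the
    increment [H] and [X'] to its right. For [X = X'] it is the directional derivative. *)
Fixpoint ncD p X X' H : 'M[R]_n :=
  match p with
  | NCVar i => H i
  | NCConst c => 0
  | NCAdd p q => ncD p X X' H + ncD q X X' H
  | NCMul p q => nceval p X *m ncD q X X' H + ncD p X X' H *m nceval q X'
  end.

Lemma ncD_diff p X X' : ncD p X X' [ffun i => X i - X' i] = nceval p X - nceval p X'.
Proof.
elim: p => /= [i|c|p -> q ->|p -> q ->]; rewrite ?ffunE ?subrr //.
  by rewrite opprD addrACA.
by rewrite mulmxBr mulmxBl addrA subrK.
Qed.

Lemma ncD_sum (I : finType) (h : I -> R) (H : I -> {ffun 'I_N -> 'M[R]_n}) p X X' :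
  ncD p X X' [ffun i => \sum_l h l *: H l i] = \sum_l h l *: ncD p X X' (H l).
Proof.
elim: p => /= [i|c|p -> q ->|p -> q ->]; rewrite ?ffunE //.
- by rewrite big1 // => l _; rewrite scaler0.
- by rewrite -big_split; apply: eq_bigr => l _; rewrite scalerDr.
- rewrite mulmx_sumr mulmx_suml -big_split; apply: eq_bigr => l _ /=.
  by rewrite scalerDr -scalemxAr -scalemxAl.
Qed.

Lemma nceval_block p X X' H :
  nceval p [ffun i => block_mx (X i) (H i) 0 (X' i)] =
  block_mx (nceval p X) (ncD p X X' H) 0 (nceval p X').
Proof.
elim: p => /= [i|c|p -> q ->|p -> q ->]; first by rewrite ffunE.
- by rewrite -scalar_mx_block.
- by rewrite add_block_mx addr0.
- by rewrite mulmx_block !mul0mx !mulmx0 !addr0 !add0r.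
Qed.
End Derivative.

Lemma ncD_map N n (R S : comNzRingType) (f : {rmorphism R -> S}) p
    (X X' H : {ffun 'I_N -> 'M[R]_n}) :
  map_mx f (ncD p X X' H) = ncD (ncmap f p) (mapX f X) (mapX f X') (mapX f H).
Proof.
elim: p => /= [i|c|p IHp q IHq|p IHp q IHq]; first by rewrite ffunE.
- exact: map_mx0.
- by rewrite map_mxD IHp IHq.
- by rewrite map_mxD !map_mxM IHp IHq !nceval_map.
Qed.

(** * Entrywise coordinates and the Jacobian between two points *)

Section Coordinates.
Variables N n : nat.
Definition coord := ('I_N * ('I_n * 'I_n))%type.
Definition ncoord := #|{: coord}|.

Definition tomx (R : Type) (x : 'I_ncoord -> R) : {ffun 'I_N -> 'M[R]_n} :=
  [ffun i => \matrix_(a, b) x (enum_rank ((i, (a, b)) : coord))].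
Definition tovec (R : Type) (X : {ffun 'I_N -> 'M[R]_n}) (k : 'I_ncoord) : R :=
  let u : coord := enum_val k in X u.1 u.2.1 u.2.2.

Lemma tomxK R (x : 'I_ncoord -> R) k : tovec (tomx x) k = x k.
Proof.
rewrite /tovec /tomx ffunE mxE; case E: (enum_val k) => [i [a b]] /=.
by rewrite -E enum_valK.
Qed.

Lemma tovecK R (X : {ffun 'I_N -> 'M[R]_n}) : tomx (tovec X) = X.
Proof.
by apply/ffunP=> i; apply/matrixP=> a b; rewrite ffunE mxE /tovec enum_rankK.
Qed.

Lemma eq_tomx R (x y : 'I_ncoord -> R) : x =1 y -> tomx x = tomx y.
Proof. by move=> e; apply/ffunP=> i; apply/matrixP=> a b; rewrite !ffunE !mxE e. Qed.

Lemma mapX_tomx R S (f : R -> S) (x : 'I_ncoord -> R) : mapX f (tomx x) = tomx (f \o x).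
Proof. by apply/ffunP=> i; apply/matrixP=> a b; rewrite !ffunE !mxE. Qed.

Lemma tovec_mapX R S (f : R -> S) X k : tovec (mapX f X) k = f (tovec X k).
Proof. by rewrite /tovec ffunE mxE. Qed.
End Coordinates.

Section Level.
Variables (N n : nat) (C : closedFieldType) (P : free_poly_map N C).
Local Notation m := (ncoord N n).

Definition ncev (B : comNzRingType) (f : C -> B) (X : {ffun 'I_N -> 'M[B]_n}) :=
  [ffun i => nceval (ncmap f (P i)) X].

(** The value of [P] at generic matrices, whose entries are independent variables. *)
Definition entries (k : 'I_m) : {mpoly C[m]} :=
  tovec (ncev (@mpolyC m C) (tomx (fun k => 'X_k))) k.

Lemma entriesE (B : comNzRingType) (f : {rmorphism C -> B}) (x : 'I_m -> B) k :
  mmap f x (entries k) = tovec (ncev f (tomx x)) k.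
Proof.
rewrite /entries -[LHS]tovec_mapX; congr (@tovec _ _ _ _ k); apply/ffunP=> i; rewrite !ffunE.
rewrite nceval_map (@ncmap_comp _ _ _ _ _ _ f) => [|c]; last by rewrite /= mmapC.
by congr nceval; rewrite mapX_tomx; apply: eq_tomx => j /=; rewrite mmapU.
Qed.

Definition jacobian (B : comNzRingType) (f : C -> B) (x x' : 'I_m -> B) : 'M[B]_m :=
  \matrix_(k, l) tovec [ffun i => ncD (ncmap f (P i)) (tomx x) (tomx x')
     (tomx (fun j => (j == l)%:R))] k.

Lemma jacobianE (B : comNzRingType) (f : C -> B) (x x' : 'I_m -> B) (h : 'cV[B]_m) k :
  (jacobian f x x' *m h) k 0 =
  tovec [ffun i => ncD (ncmap f (P i)) (tomx x) (tomx x') (tomx (fun j => h j 0))] k.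
Proof.
have -> : tomx (fun j => h j 0) =
    [ffun i => \sum_l h l 0 *: (tomx (fun j => (j == l)%:R) : {ffun 'I_N -> 'M[B]_n}) i].
  apply/ffunP=> i; apply/matrixP=> a b; rewrite !ffunE summxE mxE.
  rewrite (bigD1 (enum_rank ((i, (a, b)) : coord N n))) //= big1 => [|l ne_l].
    by rewrite !ffunE !mxE eqxx mulr1 addr0.
  by rewrite !ffunE !mxE eq_sym (negPf ne_l) mulr0.
rewrite /tovec ffunE ncD_sum summxE mxE; apply: eq_bigr => l _.
by rewrite !mxE /tovec ffunE mulrC.
Qed.

Lemma jacobian_map (B B' : comNzRingType) (f : C -> B) (g : {rmorphism B -> B'}) (f' : C -> B')
    (x x' : 'I_m -> B) : (forall c, g (f c) = f' c) ->
  map_mx g (jacobian f x x') = jacobian f' (g \o x) (g \o x').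
Proof.
move=> e; apply/matrixP=> k l; rewrite !mxE -[LHS]tovec_mapX; congr (@tovec _ _ _ _ k).
apply/ffunP=> i; rewrite !ffunE ncD_map (ncmap_comp _ e) !mapX_tomx; congr ncD.
by apply: eq_tomx => j /=; rewrite rmorph_nat.
Qed.

Hypothesis injP : injective (@fpm_eval C N (n + n) P).

(** A kernel vector, put as the off-diagonal block between [x] and [x'], leaves the value of [P] the
    same as for the zero block; injectivity makes it zero. *)
Lemma jacobian_det (x x' : 'I_m -> C) : \det (jacobian id x x') != 0.
Proof.
rewrite -det_tr; apply/det0P => -[v v0 vJ]; case/eqP: v0.
have Jv : jacobian id x x' *m v^T = 0 by rewrite -[LHS]trmxK trmx_mul trmxK vJ trmx0.
pose H := tomx (fun j => v^T j 0).
have D0 i : ncD (P i) (tomx x) (tomx x') H = 0.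
  suff e : [ffun i => ncD (ncmap id (P i)) (tomx x) (tomx x') H] = [ffun i => 0].
    by move/ffunP/(_ i): e; rewrite !ffunE ncmap_id.
  rewrite -[LHS]tovecK -[RHS]tovecK; apply: eq_tomx => k.
  by rewrite -jacobianE Jv mxE /tovec ffunE mxE.
have /injP/ffunP e : fpm_eval P [ffun i => block_mx (tomx x i) (H i) 0 (tomx x' i)]
    = fpm_eval P [ffun i => block_mx (tomx x i) ([ffun=> 0] i) 0 (tomx x' i)].
  apply/ffunP=> i; rewrite !ffunE !nceval_block D0; congr block_mx.
  (* The derivative in direction 0 vanishes: it is the empty case of linearity. *)
  have := @ncD_sum N n C 'I_0 (fun=> 0) (fun=> [ffun=> 0]) (P i) (tomx x) (tomx x').
  rewrite big_ord0 => {1}<-; congr ncD; apply/ffunP=> j.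
  by rewrite !ffunE big_ord0.
apply/rowP=> j; rewrite mxE.
have := tomxK (fun j => v^T j 0) j; rewrite mxE => <-; rewrite -/H /tovec.
case: (enum_val j) => i [a b] /=; have := e i; rewrite !ffunE => /eq_block_mx[_ -> _ _].
by rewrite ?ffunE mxE.
Qed.
End Level.

(** On the line through 0 and [z], [f] is a univariate polynomial without roots, hence constant; so
    [f] takes the same value at [z] and at 0. *)
Lemma nonvanishing_const (C : closedFieldType) k (f : {mpoly C[k]}) :
  (forall z, f.@[z] != 0) -> exists2 c, c != 0 & f = c%:MP.
Proof.
move=> f0; exists f.@[fun=> 0]; first exact: f0.
apply/eqP; rewrite -subr_eq0; apply: contraT => /mpoly_nonroot[z].
rewrite mevalB mevalC subr_eq0; case/eqP.
pose g := mmap (@polyC C) (fun j => 'X * (z j)%:P) f.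
have gE t : g.[t] = f.@[fun j => t * z j].
  rewrite -[LHS]/(horner_eval t g) mmap_morph; apply: eq_mmap => [c|j] /=.
    by rewrite /horner_eval hornerC.
  by rewrite /horner_eval !hornerE.
have sg : size g = 1%N.
  apply/eqP; rewrite -[_ == _]negbK; apply/closed_rootP => -[t].
  by rewrite rootE gE (negPf (f0 _)).
have gC := size1_polyC (eq_leq sg).
rewrite (@meval_eq _ _ z (fun j => 1 * z j)) => [|j]; last by rewrite mul1r.
rewrite (@meval_eq _ _ (fun=> 0) (fun j => 0 * z j)) => [|j]; last by rewrite mul0r.
by rewrite -!gE gC !hornerC.
Qed.

Section LevelInverse.
Variables (N n : nat) (C : closedFieldType) (P : free_poly_map N C).
Hypothesis C0 : [pchar C] =i pred0.
Local Notation m := (ncoord N n).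
Hypothesis injP : injective (@fpm_eval C N (n + n) P).
Local Notation p := (@entries N n C P).

(* The Jacobian between two points of M_n(C)^N is the off-diagonal block of P at a block
   upper triangular point of M_2n(C)^N, hence injectivity at level 2n inverts it. *)
Lemma entries_certified : exists Q, certified p Q.
Proof.
pose x k : {mpoly C[m + m]} := 'X_(lshift m k).
pose x' k : {mpoly C[m + m]} := 'X_(rshift m k).
pose J := jacobian P (@mpolyC (m + m) C) x x'.
have [|c c0 detJ] := @nonvanishing_const C (m + m) (\det J).
  move=> z; rewrite -[X in X != 0]/(meval z (\det J)) -det_map_mx.
  rewrite (jacobian_map _ _ _ (f' := id)) => [|d]; last by rewrite /= mevalC.
  exact: jacobian_det.
(* The inverse of [J] by Cramer's rule. It applies because [J] maps [x - x'] to [p(x) - p(x')]. *)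
exists (fun k j => (c^-1)%:MP * \adj J k j) => k.
apply/eqP; rewrite subr_eq0; apply/eqP.
pose h := \col_j (x j - x' j).
have Jh : J *m h = \col_j (lvars (p j) - rvars (p j)).
  apply/colP=> j; rewrite jacobianE mxE /lvars /rvars !entriesE /tovec !ffunE.
  have -> : tomx (fun j => h j 0) = [ffun i => tomx x i - tomx x' i].
    by apply/ffunP=> i; apply/matrixP=> a b; rewrite !ffunE !mxE.
  by rewrite ncD_diff !mxE.
have := congr1 (fun v => (c^-1)%:MP * (\adj J *m v) k 0) Jh.
rewrite mulmxA mul_adj_mx detJ mul_scalar_mx !mxE mulrA -rmorphM mulVf // rmorph1 mul1r.
rewrite -/(x k) -/(x' k) => ->; rewrite mulr_sumr; apply: eq_bigr => j _.
by rewrite mulrA; congr (_ * _); apply: mxE.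
Qed.

(** [F] is a left inverse of [p] by [certified_inverse]. Hence [p_k(F) - 'X_k] becomes 0 after
    substituting [p], and algebraic independence of [p] makes it 0. *)
Lemma level_inverse : exists F : 'I_m -> {mpoly C[m]},
  (forall k, compm p (F k) = 'X_k) /\ (forall k, compm F (p k) = 'X_k).
Proof.
have [Q cpQ] := entries_certified.
have [F FE] := boolp.choice (certified_inverse C0 cpQ).
exists F; split=> // k; apply/eqP; rewrite -subr_eq0; apply: contraT => /mpoly_nonroot[y].
case/eqP; apply: (certified_independent C0 cpQ).
rewrite rmorphB /= mmapU; apply/eqP; rewrite subr_eq0; apply/eqP.
rewrite mmap_morph -[RHS]mmap_id; apply: eq_mmap => [c|j] /=; first by rewrite mmapC.
exact: FE.
Qed.

(** Polynomial identities hold in every commutative [C]-algebra; below [B] is [C] or the ring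
    [{poly C}] of a parameter s. *)
Lemma level_inverse_ring : exists F : 'I_m -> {mpoly C[m]},
  forall (B : comNzRingType) (f : {rmorphism C -> B}),
  let G Y := tomx (fun k => mmap f (tovec Y) (F k)) in
  cancel (ncev P f) G /\ cancel G (ncev P f).
Proof.
have [F [Fp pF]] := level_inverse; exists F => B f G; split=> X.
  rewrite -[RHS]tovecK; apply: eq_tomx => k.
  have := congr1 (mmap f (tovec X)) (Fp k); rewrite mmapU => <-.
  rewrite mmap_morph; apply: eq_mmap => [c|j] /=; first by rewrite mmapC.
  by rewrite entriesE tovecK.
rewrite -[LHS]tovecK -[RHS]tovecK; apply: eq_tomx => k.
have := congr1 (mmap f (tovec X)) (pF k); rewrite mmapU => <-.
rewrite mmap_morph -entriesE; apply: eq_mmap => [c|j] //=.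
by rewrite mmapC.
Qed.
End LevelInverse.

(** * Truncation of the formal inverse *)

Section Syntax.
Variables (N : nat) (R : comNzRingType).
Implicit Types p q : ncpoly N R.

Fixpoint nc0 p : R :=
  match p with
  | NCVar i => 0
  | NCConst c => c
  | NCAdd p q => nc0 p + nc0 q
  | NCMul p q => nc0 p * nc0 q
  end.

Fixpoint nclin p (i : 'I_N) : R :=
  match p with
  | NCVar j => (i == j)%:R
  | NCConst c => 0
  | NCAdd p q => nclin p i + nclin q i
  | NCMul p q => nclin p i * nc0 q + nc0 p * nclin q i
  end.

Fixpoint ncsubst (G : 'I_N -> ncpoly N R) p : ncpoly N R :=
  match p with
  | NCVar i => G i
  | NCConst c => NCConst c
  | NCAdd p q => NCAdd (ncsubst G p) (ncsubst G q)
  | NCMul p q => NCMul (ncsubst G p) (ncsubst G q)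
  end.

Definition ncsum (s : seq (ncpoly N R)) := foldr (@NCAdd N R) (NCConst 0) s.

Fixpoint nchomog p (k : nat) : ncpoly N R :=
  match p with
  | NCVar i => if k == 1%N then NCVar i else NCConst 0
  | NCConst c => if k == 0%N then NCConst c else NCConst 0
  | NCAdd p q => NCAdd (nchomog p k) (nchomog q k)
  | NCMul p q => ncsum [seq NCMul (nchomog p (val j)) (nchomog q (k - val j)) | j <- enum 'I_k.+1]
  end.

Definition nctranslate (c : 'I_N -> R) (i : 'I_N) : ncpoly N R := NCAdd (NCVar i) (NCConst (c i)).

Lemma nceval_subst n (X : {ffun 'I_N -> 'M[R]_n}) G p :
  nceval (ncsubst G p) X = nceval p [ffun i => nceval (G i) X].
Proof. by elim: p => //= [i|p -> q ->|p -> q ->]; rewrite ?ffunE. Qed.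

Lemma nceval_sum n (X : {ffun 'I_N -> 'M[R]_n}) I (s : seq I) (f : I -> ncpoly N R) :
  nceval (ncsum [seq f i | i <- s]) X = \sum_(i <- s) nceval (f i) X.
Proof.
elim: s => [|i s IH] /=; first by rewrite big_nil raddf0.
by rewrite big_cons IH.
Qed.

Lemma nceval_zero n (X : {ffun 'I_N -> 'M[R]_n}) p :
  (forall i, X i = 0) -> nceval p X = (nc0 p)%:M.
Proof.
move=> X0; elim: p => /= [i|c|p -> q ->|p -> q ->] //.
- by rewrite X0 raddf0.
- by rewrite raddfD.
- by rewrite scalar_mxM.
Qed.

(** All terms of degree at least 2 contain [E *m E], so only the constant and linear parts
    remain. *)
Lemma nceval_square_zero n (E : 'M[R]_n) (h : 'I_N -> R) p : E *m E = 0 ->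
  nceval p [ffun i => h i *: E] = (nc0 p)%:M + (\sum_i nclin p i * h i) *: E.
Proof.
move=> EE; elim: p => /= [i|c|p -> q ->|p -> q ->].
- rewrite ffunE raddf0 add0r (bigD1 i) //= eqxx mul1r big1 ?addr0 // => j /negPf ->.
  by rewrite mul0r.
- by rewrite big1 ?scale0r ?addr0 // => j _; rewrite mul0r.
- rewrite raddfD /= addrACA -scalerDl -big_split; congr (_ + _ *: _).
  by apply: eq_bigr => i _; rewrite mulrDl.
rewrite mulmxDl !mulmxDr -!scalemxAl -!scalemxAr EE !scaler0 addr0 -scalar_mxM.
rewrite -addrA mul_scalar_mx mul_mx_scalar !scalerA -scalerDl addrC [in RHS]addrC.
congr (_ *: _ + _); rewrite !mulr_suml -big_split.
by apply: eq_bigr => i _ /=; ring.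
Qed.
End Syntax.

Lemma nc0_map N (R S : comNzRingType) (f : {rmorphism R -> S}) (p : ncpoly N R) :
  nc0 (ncmap f p) = f (nc0 p).
Proof.
elim: p => /= [i|c|p -> q ->|p -> q ->] //; first by rewrite rmorph0.
  by rewrite rmorphD.
by rewrite rmorphM.
Qed.

Lemma nclin_map N (R S : comNzRingType) (f : {rmorphism R -> S}) (p : ncpoly N R) i :
  nclin (ncmap f p) i = f (nclin p i).
Proof.
elim: p => /= [j|c|p -> q ->|p -> q ->]; first by rewrite rmorph_nat.
- by rewrite rmorph0.
- by rewrite rmorphD.
- by rewrite rmorphD !rmorphM !nc0_map.
Qed.

Lemma ncmap_subst N (R S : comNzRingType) (f : R -> S) (G : 'I_N -> ncpoly N R) p :
  ncmap f (ncsubst G p) = ncsubst (fun i => ncmap f (G i)) (ncmap f p).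
Proof. by elim: p => //= [p -> q ->|p -> q ->]. Qed.

Lemma ncmap_sum N (R S : comNzRingType) (f : {rmorphism R -> S}) (s : seq (ncpoly N R)) :
  ncmap f (ncsum s) = ncsum [seq ncmap f p | p <- s].
Proof. by elim: s => /= [|p s ->]; rewrite ?rmorph0. Qed.

Section Homogeneous.
Variables (N n : nat) (R : comNzRingType).

Lemma coef_mulmx k (A B : 'M[{poly R}]_n) :
  map_mx (coefp k) (A *m B) = \sum_(j < k.+1) map_mx (coefp j) A *m map_mx (coefp (k - j)) B.
Proof.
apply/matrixP=> a b; rewrite summxE !mxE /= coef_sum.
under [RHS]eq_bigr => j _ do rewrite mxE.
rewrite exchange_big; apply: eq_bigr => l _; rewrite coefM; apply: eq_bigr => j _.
by rewrite !mxE.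
Qed.

(** Scaling the argument by a parameter separates the homogeneous parts as its coefficients. *)
Lemma nchomogE (p : ncpoly N R) (Y : {ffun 'I_N -> 'M[R]_n}) k :
  map_mx (coefp k) (nceval (ncmap polyC p) [ffun i => 'X *: map_mx polyC (Y i)]) =
  nceval (nchomog p k) Y.
Proof.
elim: p k => /= [i|c|p IHp q IHq|p IHp q IHq] k.
- apply/matrixP=> a b; rewrite ffunE !mxE /= mulrC coefMX coefC.
  by case: k => [|[|k]] //=; rewrite ?mxE ?mul0rn.
- by apply/matrixP=> a b; case: k => [|k]; rewrite /= !mxE /= coefMn coefC ?mul0rn.
- by rewrite -IHp -IHq; apply/matrixP=> a b; rewrite !mxE /= coefD.
- rewrite coef_mulmx nceval_sum big_enum /=; apply: eq_bigr => j _.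
  by rewrite IHp IHq.
Qed.
End Homogeneous.

Lemma subr_addACA (V : zmodType) (a b c d e f : V) :
  a + b - (c + d) - (e + f) = (a - c - e) + (b - d - f).
Proof. by rewrite (opprD c d) (opprD e f) (addrACA a) [LHS]addrACA. Qed.

Lemma telescope_mul (V : zmodType) (a b c d e f g : V) :
  a - c - (d + e) = (a - b - f) + (f - d) + ((b - c - g) + (g - e)).
Proof.
rewrite !subrKA [RHS]addrAC -(addrA b) subrKA opprD !addrA.
by rewrite [RHS]addrAC.
Qed.

(** * Congruences modulo powers of the parameter, and Newton's iteration *)

Section Congruence.
Variables (N n : nat) (R : comNzRingType).
Implicit Types (M : 'M[{poly R}]_n) (X : {ffun 'I_N -> 'M[{poly R}]_n}).

Definition Xdvd d M := exists E, M = 'X^d *: E.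

Lemma Xdvd0 d : Xdvd d 0. Proof. by exists 0; rewrite scaler0. Qed.
Lemma XdvdD d M M' : Xdvd d M -> Xdvd d M' -> Xdvd d (M + M').
Proof. by move=> [E ->] [E' ->]; exists (E + E'); rewrite scalerDr. Qed.
Lemma XdvdZ d c M : Xdvd d M -> Xdvd d (c *: M).
Proof. by move=> [E ->]; exists (c *: E); rewrite !scalerA mulrC. Qed.
Lemma Xdvd_sum d (I : finType) (F : I -> 'M[{poly R}]_n) :
  (forall i, Xdvd d (F i)) -> Xdvd d (\sum_i F i).
Proof. by move=> H; apply: big_ind => [|M M'|i _] //; [apply: Xdvd0|apply: XdvdD]. Qed.
Lemma XdvdM d d' M M' : Xdvd d M -> Xdvd d' M' -> Xdvd (d + d') (M *m M').
Proof.
move=> [E ->] [E' ->]; exists (E *m E').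
by rewrite -scalemxAl -scalemxAr scalerA -exprD.
Qed.
Lemma XdvdMl d M M' : Xdvd d M' -> Xdvd d (M *m M').
Proof. by move=> H; rewrite -[d]add0n; apply: XdvdM => //; exists M; rewrite scale1r. Qed.
Lemma XdvdMr d M M' : Xdvd d M -> Xdvd d (M *m M').
Proof. by move=> H; rewrite -[d]addn0; apply: XdvdM => //; exists M'; rewrite scale1r. Qed.
Lemma Xdvd_leq d d' M : (d <= d')%N -> Xdvd d' M -> Xdvd d M.
Proof. by move=> le_d [E ->]; exists ('X^(d' - d) *: E); rewrite scalerA -exprD subnKC. Qed.

Lemma nceval_Xdvd p X : (forall i, Xdvd 1 (X i)) -> Xdvd 1 (nceval p X - (nc0 p)%:M).
Proof.
move=> X1; elim: p => /= [i|c|p IHp q IHq|p IHp q IHq].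
- by rewrite raddf0 subr0.
- by rewrite subrr; apply: Xdvd0.
- by rewrite raddfD opprD addrACA; apply: XdvdD.
rewrite scalar_mxM.
have -> : nceval p X *m nceval q X - (nc0 p)%:M *m (nc0 q)%:M =
    nceval p X *m (nceval q X - (nc0 q)%:M) + (nceval p X - (nc0 p)%:M) *m (nc0 q)%:M.
  by rewrite mulmxBr mulmxBl addrA subrK.
by apply: XdvdD; [apply: XdvdMl|apply: XdvdMr].
Qed.

(** First-order Taylor expansion. In a nonlinear term, a difference divisible by ['X^d] is
    multiplied by an entry of [X] or [X'], which brings one more factor ['X]. *)
Lemma nceval_first_order p X X' d :
  (forall i, Xdvd 1 (X i)) -> (forall i, Xdvd 1 (X' i)) ->
  (forall i, Xdvd d (X i - X' i)) ->
  Xdvd d.+1 (nceval p X - nceval p X' - \sum_i nclin p i *: (X i - X' i)).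
Proof.
move=> X1 X1' XX'; elim: p => /= [i|c|p IHp q IHq|p IHp q IHq].
- rewrite (bigD1 i) //= eqxx scale1r big1 ?addr0 ?subrr; first exact: Xdvd0.
  by move=> j /negPf ->; rewrite scale0r.
- rewrite subrr big1 ?subrr => [|i _]; first exact: Xdvd0.
  by rewrite scale0r.
- under eq_bigr => i _ do rewrite scalerDl.
  by rewrite big_split /= subr_addACA; apply: XdvdD.
pose S r := \sum_i nclin r i *: (X i - X' i).
have Sd r : Xdvd d (S r) by apply: Xdvd_sum => i; apply: XdvdZ; apply: XX'.
have -> : \sum_i (nclin p i * nc0 q + nc0 p * nclin q i) *: (X i - X' i) =
    S p *m (nc0 q)%:M + (nc0 p)%:M *m S q.
  rewrite mul_scalar_mx mul_mx_scalar !scaler_sumr -big_split; apply: eq_bigr => i _ /=.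
  by rewrite !scalerA -scalerDl [nc0 q * _]mulrC.
have -> : nceval p X *m nceval q X - nceval p X' *m nceval q X' -
    (S p *m (nc0 q)%:M + (nc0 p)%:M *m S q) =
    (nceval p X - nceval p X' - S p) *m nceval q X + S p *m (nceval q X - (nc0 q)%:M)
    + (nceval p X' *m (nceval q X - nceval q X' - S q)
      + (nceval p X' - (nc0 p)%:M) *m S q).
  by rewrite !mulmxBl !mulmxBr; apply: telescope_mul.
have pd : Xdvd d.+1 (S p *m (nceval q X - (nc0 q)%:M)).
  by rewrite -addn1; apply: XdvdM => //; apply: nceval_Xdvd.
have qd : Xdvd d.+1 ((nceval p X' - (nc0 p)%:M) *m S q).
  by rewrite -add1n; apply: XdvdM => //; apply: nceval_Xdvd.
by apply: (XdvdD (XdvdD _ pd) (XdvdD _ qd)); [apply: XdvdMr|apply: XdvdMl].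
Qed.
End Congruence.

Section Newton.
Variables (N : nat) (R : comNzRingType) (P : 'I_N -> ncpoly N R) (A : 'M[R]_N).

(* Newton's iteration G <- G - A (P(G) - y) for the formal inverse of P. *)
Fixpoint newton (d : nat) (i : 'I_N) : ncpoly N R :=
  if d is d'.+1 then
    NCAdd (newton d' i) (ncsum [seq NCMul (NCConst (- A i j))
      (NCAdd (ncsubst (newton d') (P j)) (NCMul (NCConst (-1)) (NCVar j))) | j <- enum 'I_N])
  else NCConst 0.

Hypothesis AP : forall i k, \sum_j A i j * nclin (P j) k = (i == k)%:R.
Variable n : nat.
Local Notation ev p := (nceval (n := n) (ncmap (@polyC R) p)).

(** With [G] the current iterate, [P(G) - P(X)] is the linear part of [P] applied to [G - X], up to
    one more order. As [A] inverts the linear part, the correction cancels [G - X] and only the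
    images under [A] of the Taylor remainders [E j] are left. *)
Lemma newton_approx (X : {ffun 'I_N -> 'M[{poly R}]_n}) d i : (forall i, Xdvd 1 (X i)) ->
  Xdvd d.+1 (ev (newton d i) [ffun j => ev (P j) X] - X i).
Proof.
move=> X1; set Y := [ffun j => _]; elim: d i => [|d IH] i.
  by rewrite /= raddf0 sub0r -scaleN1r; apply: XdvdZ.
pose G := [ffun j => ev (newton d j) Y].
have GX j : Xdvd d.+1 (G j - X j) by rewrite ffunE.
have G1 j : Xdvd 1 (G j).
  by rewrite -[G j](subrK (X j)); apply: XdvdD => //; apply: Xdvd_leq (GX j).
pose E j := ev (P j) G - ev (P j) X - \sum_k (nclin (P j) k)%:P *: (G k - X k).
have E2 j : Xdvd d.+2 (E j).
  have := nceval_first_order (ncmap polyC (P j)) G1 X1 GX; rewrite /E.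
  by under eq_bigr => k _ do rewrite nclin_map.
suff -> : ev (newton d.+1 i) Y - X i = - \sum_j (A i j)%:P *: E j.
  by rewrite -scaleN1r; apply/XdvdZ/Xdvd_sum => j; apply: XdvdZ.
have -> : ev (newton d.+1 i) Y = G i - \sum_j (A i j)%:P *: (ev (P j) G - Y j).
  rewrite /= ffunE; congr (_ + _); rewrite ncmap_sum -map_comp nceval_sum big_enum /= -sumrN.
  apply: eq_bigr => j _; rewrite ncmap_subst nceval_subst -/G rmorphN mul_scalar_mx scaleNr.
  by rewrite rmorphN rmorph1 mul_scalar_mx scaleN1r.
have -> : \sum_j (A i j)%:P *: (ev (P j) G - Y j) =
    \sum_j (A i j)%:P *: E j + (G i - X i).
  have -> : G i - X i = \sum_j \sum_k ((A i j)%:P * (nclin (P j) k)%:P) *: (G k - X k).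
    have AP' k : \sum_j (A i j)%:P * (nclin (P j) k)%:P = (i == k)%:R.
      rewrite -(rmorph_nat polyC) -AP rmorph_sum.
      by apply: eq_bigr => j _; rewrite rmorphM.
    rewrite exchange_big /= (bigD1 i) //= -scaler_suml AP' eqxx scale1r.
    rewrite big1 ?addr0 // => k ne_k.
    by rewrite -scaler_suml AP' eq_sym (negPf ne_k) scale0r.
  rewrite -big_split; apply: eq_bigr => j _ /=.
  under eq_bigr => k _ do rewrite -scalerA.
  by rewrite -scaler_sumr -scalerDr /E subrK ffunE.
by rewrite opprD opprB addrCA [G i + _]addrC subrK addrK.
Qed.
End Newton.

(** * Order of vanishing, degree bound and conclusion *)

Lemma Xdvd1P n (R : comNzRingType) (M : 'M[{poly R}]_n) :
  map_mx (horner_eval 0) M = 0 -> Xdvd 1 M.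
Proof.
move=> M0; exists (map_mx (drop_poly 1) M); apply/matrixP=> a b; rewrite !mxE.
rewrite -[LHS](poly_take_drop 1) mulrC [take_poly _ _](_ : _ = 0) ?add0r //.
apply/polyP=> -[|k]; rewrite coef_take_poly coef0 //=.
by move/matrixP/(_ a b): M0; rewrite !mxE /horner_eval horner_coef0.
Qed.

Lemma size_mmap_leq (R : comNzRingType) k (z : 'I_k -> {poly R}) (f : {mpoly R[k]}) :
  (forall j, size (z j) <= 2)%N -> (size (mmap (@polyC R) z f) <= msize f)%N.
Proof.
move=> z2; rewrite /mmap big_seq.
apply: (big_ind (fun q : {poly R} => (size q <= msize f)%N)) => [|q q' sq sq'|a af].
- by rewrite size_poly0.
- by rewrite (leq_trans (size_polyD _ _)) // geq_max sq.
rewrite mul_polyC (leq_trans (size_scale_leq _ _)) //.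
apply: leq_trans (msize_mdeg_lt af); rewrite mdegE /mmap1.
apply: (big_ind2 (fun (q : {poly R}) s => (size q <= s.+1)%N)) => [|q s q' s' sq sq'|j _].
- by rewrite size_poly1.
- apply: leq_trans (size_polyMleq _ _) _.
  by rewrite -subn1 leq_subLR (leq_trans (leq_add sq sq')) // addSn addnS.
- apply: leq_trans (size_poly_exp_leq _ _) _; rewrite ltnS.
  by rewrite -[X in (_ <= X)%N]mul1n leq_mul2r -subn1 leq_subLR z2 orbT.
Qed.

(** For [v] in the kernel of the linear part and a nonzero [E] of square zero, the tuples [v_i E]
    and 0 have the same image. *)
Lemma linear_part_unit (C : fieldType) N (P : free_poly_map N C) :
  injective (@fpm_eval C N 2 P) -> (\matrix_(j, k) nclin (P j) k) \in unitmx.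
Proof.
move=> injP; rewrite unitmxE unitfE -det_tr; apply/det0P => -[v v0 vL].
case/eqP: v0; pose E : 'M[C]_2 := delta_mx 0 1.
have EE : E *m E = 0 by rewrite mul_delta_mx_0.
have PE (h : 'I_N -> C) : (forall j, \sum_k nclin (P j) k * h k = 0) ->
    fpm_eval P [ffun i => h i *: E] = [ffun i => (nc0 (P i))%:M].
  by move=> h0; apply/ffunP=> i; rewrite !ffunE nceval_square_zero // h0 scale0r addr0.
have /injP/ffunP e : fpm_eval P [ffun i => v 0 i *: E] = fpm_eval P [ffun i => 0 *: E].
  rewrite (PE (fun=> 0)) => [|j]; last by rewrite big1 // => k _; rewrite mulr0.
  apply: PE => j; have /rowP/(_ j) := vL; rewrite !mxE => vLj; rewrite -[RHS]vLj.
  by apply: eq_bigr => k _; rewrite !mxE mulrC.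
apply/rowP=> i; have /matrixP/(_ 0 1) := e i.
by rewrite !ffunE !mxE !eqxx mulr1 mul0r.
Qed.

Theorem theorem4 (C : numClosedFieldType) (N : nat) (P : free_poly_map N C) :
  (* P injective on M(C)^N = disjoint union of the levels M_n(C)^N, n >= 1 *)
  (forall n : nat, (0 < n)%N -> injective (@fpm_eval C N n P)) ->
  (forall n : nat, (0 < n)%N ->
     forall Y : {ffun 'I_N -> 'M[C]_n}, exists X, fpm_eval P X = Y) /\
  (forall n : nat, (0 < n)%N ->
     exists Q : free_poly_map N C,
       forall X : {ffun 'I_N -> 'M[C]_n}, fpm_eval Q (fpm_eval P X) = X).
Proof.
move=> injP.
have ncevE n (X : {ffun 'I_N -> 'M[C]_n}) : ncev P idfun X = fpm_eval P X.
  by apply/ffunP=> i; rewrite !ffunE ncmap_id.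
have inverse n : (0 < n)%N -> _ := fun n0 => level_inverse_ring (pchar_num C)
  (injP (n + n)%N (leq_trans n0 (leq_addr _ _))).
split=> n /inverse[F FP].
  move=> Y; have [_ GK] := FP C idfun.
  by eexists; rewrite -ncevE; apply: GK.
pose L := \matrix_(j, k) nclin (P j) k.
have Lunit : L \in unitmx by apply: linear_part_unit; apply: injP.
pose A := invmx L.
have AP i k : \sum_j A i j * nclin (P j) k = (i == k)%:R.
  have := congr1 (fun M : 'M[C]_N => M i k) (mulVmx Lunit); rewrite !mxE => <-.
  by apply: eq_bigr => j _; rewrite mxE.
(* [D] exceeds the degree of every [F k], as [msize] is the degree plus one, and [c] is [P(0)]. [T]
   is the Newton iterate recentred at [c]; [Q] keeps its terms of degree below [D] in y - c. *)
pose D := \max_k msize (F k); pose c j := nc0 (P j).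
pose T i := ncsubst (nctranslate c) (newton P A D i).
pose Q i := ncsubst (nctranslate (fun j => - c j)) (ncsum [seq nchomog (T i) k | k <- iota 0 D]).
exists Q => X; apply/ffunP=> i; rewrite ffunE nceval_subst nceval_sum.
set Y := [ffun j => _].
have YE j : Y j = fpm_eval P X j - (c j)%:M.
  by rewrite ffunE /= -raddfN.
clearbody Y.
under eq_bigr => k _ do rewrite -nchomogE ncmap_subst nceval_subst.
(* The line from [P(0)] at s = 0 to [P(X)] at s = 1. Its lift [X'] through the level inverse runs
   from 0 to [X]. *)
pose Z : {ffun 'I_N -> 'M[{poly C}]_n} :=
  [ffun j => 'X *: map_mx polyC (Y j) + ((c j)%:P)%:M].
have -> : [ffun j => nceval (ncmap polyC (nctranslate c j))
    [ffun i => 'X *: map_mx polyC (Y i)]] = Z.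
  by apply/ffunP=> j; rewrite !ffunE /= !ffunE.
pose X' := tomx (fun k => mmap (@polyC C) (tovec Z) (F k)).
have X'Z : ncev P polyC X' = Z by have [_ ->] := FP _ (polyC : {rmorphism C -> {poly C}}).
have X'_at t : mapX (horner_eval t) X' =
    tomx (fun k => mmap idfun (tovec (mapX (horner_eval t) Z)) (F k)).
  rewrite mapX_tomx; apply: eq_tomx => k /=; rewrite mmap_morph.
  apply: eq_mmap => [d|j] /=; first by rewrite /horner_eval hornerC.
  by rewrite tovec_mapX.
have Z_at t : mapX (horner_eval t) Z = [ffun j => t *: Y j + (c j)%:M].
  apply/ffunP=> j; rewrite !ffunE; apply/matrixP=> a b.
  by rewrite !mxE /horner_eval hornerD hornerM hornerX hornerMn !hornerC.
have GP := (FP C idfun).1.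
have X'1 : mapX (horner_eval 1) X' = X.
  rewrite X'_at Z_at -[RHS]GP; apply: eq_tomx => k; congr mmap; congr tovec.
  by apply/ffunP=> j; rewrite !ffunE scale1r YE subrK ncmap_id ffunE.
have X'dvd j : Xdvd 1 (X' j).
  apply: Xdvd1P.
  have X'0 : mapX (horner_eval 0) X' = [ffun=> 0].
    rewrite X'_at Z_at -[RHS]GP; apply: eq_tomx => k; congr mmap; congr tovec.
    apply/ffunP=> l; rewrite !ffunE scale0r add0r ncmap_id nceval_zero // => s.
    by rewrite ffunE.
  by have /ffunP/(_ j) := X'0; rewrite !ffunE.
(* The Newton iterate along [Z] and the lift [X'] agree below order [D.+1] in s. Since [X'] has
   degree below [D], its value at s = 1 is the sum of its first [D] coefficients, which are the
   homogeneous parts kept in [Q]. *)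
have [E] := newton_approx AP D i X'dvd; rewrite -/(ncev P polyC X') X'Z => eE.
apply/matrixP=> a b; rewrite summxE -{}X'1 ffunE [RHS]mxE /horner_eval.
rewrite (@horner_coef_wide _ D); last first.
  rewrite ffunE mxE; apply: leq_trans (size_mmap_leq _ _) (leq_bigmax _) => j.
  rewrite /tovec; case: (enum_val j) => l [a' b'] /=; rewrite ffunE !mxE mulrC.
  rewrite (leq_trans (size_polyD _ _)) // geq_max mul_polyC.
  rewrite (leq_trans (size_scale_leq _ _)) ?size_polyX //=.
  by rewrite -rmorphMn (leq_trans (size_polyC_leq1 _)).
rewrite -[X in iota 0 X]subn0 -/(index_iota 0 D) big_mkord; apply: eq_bigr => k _.
rewrite expr1n mulr1 mxE /=; move/eqP: eE; rewrite subr_eq => /eqP ->.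
by rewrite mxE coefD mxE coefXnM ltnS ltnW // add0r.
Qed.
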